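(* Let $\hat p\in{}^*\mathbb N\setminus\mathbb N$ be a nonstandard prime and suppose the field $\overline{\mathbb Q}\cap\mathbb R$ of real algebraic numbers embeds (as a field) into $\mathbb F_{\hat p}$. If $\mathbb F_{\hat p}$ contains a square root of $-1$, then there is a subfield of $\mathbb F_{\hat p}$ which is almost internal, is a $\delta$-set, is algebraically closed, and has cardinality at least $\mathfrak c$. If $\mathbb F_{\hat p}$ does not contain a square root of $-1$, then there is a subfield of $\mathbb F_{\hat p}$ which is almost internal, is a $\delta$-set, is real closed, and is $\aleph_1$-saturated. In both cases there are at least $2^{\mathfrak c}$ ways to embed $\mathbb R$ into such a field.
   Context: Let $\mathcal F$ be a countably incomplete ultrafilter on a set $I$ and ${}^*\mathbb N=\mathbb N^I/\mathcal F$, with $\mathbb N\subseteq{}^*\mathbb N$ via constant sequences. With the superstructure $V(X)=\bigcup_n V_n(X)$ ($V_0(X)=X$, $V_{n+1}(X)=V_n(X)\cup\mathcal P(V_n(X))$) and the elementary embedding $*:V(\mathbb N)\to V({}^*\mathbb N)$ induced by the ultrapower, an element of $V({}^*\mathbb N)$ is internal if it lies in ${}^*A$ for some $A\in V(\mathbb N)$. For a nonstandard prime $\hat p\in{}^*P\setminus\mathbb N$ ($P$ the set of primes), $\mathbb F_{\hat p}=\{\hat n\in{}^*\mathbb N:\hat n<\hat p\}$ with operations modulo $\hat p$. A $\delta$-set is a subset of ${}^*\mathbb N$ that is an intersection of countably many internal sets. A cut is a downward-closed subset of ${}^*\mathbb N$. A set is almost internal if it equals $f^{-1}[C]$ for some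 internal function $f$ with values in ${}^*\mathbb N$ and some cut $C$. $\mathfrak c=2^{\aleph_0}$. *)

(* Defs.v *)
From HB Require Import structures.
From mathcomp Require Import all_boot all_order all_algebra generic_quotient.
From mathcomp Require Import all_classical all_reals.

Set Implicit Arguments.
Unset Strict Implicit.
Unset Printing Implicit Defensive.
Import Order.TTheory GRing.Theory Num.Theory.
Local Open Scope classical_set_scope.
Local Open Scope quotient_scope.

(* The superstructure V(X), with the elements of X taken as individuals, so
   that V_(n+1)(X) = V_n(X) `|` P(V_n(X)) is X `|` P(V_n(X)), a disjoint union.
   The inclusion of V_n(X) in V_(n+1)(X) is vembed. *)
Fixpoint superstr (X : Type) (n : nat) : Type :=
  if n is n'.+1 then (X + set (superstr X n'))%type else X.

Definition vatom (X : Type) (n : nat) : X -> superstr X n :=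
  if n is n'.+1 return X -> superstr X n then inl else id.

Fixpoint vembed (X : Type) (n : nat) : superstr X n -> superstr X n.+1 :=
  match n return superstr X n -> superstr X n.+1 with
  | 0 => fun x => inl x
  | n'.+1 => fun u =>
      match u with
      | inl x => inl x
      | inr A => inr ((@vembed X n') @` A)
      end
  end.

Fixpoint vlift (X : Type) (k n : nat) (x : superstr X n) :
    superstr X (k + n) :=
  match k return superstr X (k + n) with
  | 0 => x
  | k'.+1 => vembed (vlift k' x)
  end.

Definition vmem (X : Type) (n : nat) (x : superstr X n)
    (A : superstr X n.+1) : Prop :=
  match A with inl _ => False | inr B => B x end.

(* Kuratowski ordered pair. *)
Definition vpair (X : Type) (n : nat) (a b : superstr X n) :
    superstr X n.+2 :=
  inr [set (inr [set a] : superstr X n.+1); inr [set a; b]].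

Definition countably_incomplete (I : Type) (F : set_system I) :=
  exists A : nat -> set I, (forall k, F (A k)) /\ ~ F (\bigcap_k A k).

Section Ultrapower.
Context (I : Type) (F : set_system I) {FU : UltraFilter F}.

Definition ueq (f g : I -> nat) : bool := `[< F [set i | f i = g i] >].

Lemma ueq_refl : reflexive ueq.
Proof. by move=> f; apply/asboolP; apply: filterS filterT. Qed.

Lemma ueq_sym : symmetric ueq.
Proof.
by move=> f g; apply/asboolP/asboolP; apply: filterS => i /= ->.
Qed.

Lemma ueq_trans : transitive ueq.
Proof.
move=> g f h /asboolP fg /asboolP gh; apply/asboolP.
by apply: filterS2 fg gh => i /= ->.
Qed.

Canonical ueq_equiv := EquivRel ueq ueq_refl ueq_sym ueq_trans.

Definition hypernat := {eq_quot ueq_equiv}.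
HB.instance Definition _ := Choice.on hypernat.
HB.instance Definition _ := EqQuotient.on hypernat.

Definition std (n : nat) : hypernat := \pi_hypernat (fun _ => n).

Definition hop (op : nat -> nat -> nat) (x y : hypernat) : hypernat :=
  \pi_hypernat (fun i => op (repr x i) (repr y i)).

Definition hle (x y : hypernat) : bool :=
  `[< F [set i | repr x i <= repr y i] >].
Definition hlt (x y : hypernat) : bool :=
  `[< F [set i | repr x i < repr y i] >].

(* The value in V( *N ) of a rank-bounded family in V(N): the class of the
   family in the bounded ultrapower, followed by the Mostowski collapse. *)
Fixpoint ultraval (n : nat) : (I -> superstr nat n) -> superstr hypernat n :=
  match n return (I -> superstr nat n) -> superstr hypernat n with
  | 0 => fun f => \pi_hypernat f
  | n'.+1 => fun f =>
      if `[< F [set i | exists a, f i = inl a] >]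
      then inl (\pi_hypernat (fun i => if f i is inl a then a else 0))
      else inr [set y | exists2 g : I -> superstr nat n',
                          F [set i | vmem (g i) (f i)] & y = ultraval g]
  end.

Definition star (n : nat) (a : superstr nat n) : superstr hypernat n :=
  ultraval (fun _ => a).

Definition internal (n : nat) (x : superstr hypernat n) : Prop :=
  exists (k : nat) (A : superstr nat (k + n).+1), vmem (vlift k x) (star A).

Definition delta_set (A : set hypernat) : Prop :=
  exists B : nat -> set hypernat,
    (forall k, internal (inr (B k) : superstr hypernat 1)) /\
    A = \bigcap_k B k.

Definition cut (C : set hypernat) : Prop :=
  forall x y, hle x y -> C y -> C x.

Definition hypernat_valued_function (n : nat) (f : superstr hypernat n.+3) :=
  [/\ exists G, f = inr G,
      forall z, vmem z f -> exists a c, z = vpair a (vatom n c)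
    & forall a c c', vmem (vpair a (vatom n c)) f ->
                     vmem (vpair a (vatom n c')) f -> c = c'].

Definition vpreimage (n : nat) (f : superstr hypernat n.+3)
    (C : set hypernat) : set (superstr hypernat n) :=
  [set a | exists2 c, C c & vmem (vpair a (vatom n c)) f].

Definition almost_internal (A : set hypernat) : Prop :=
  exists (n : nat) (f : superstr hypernat n.+3) (C : set hypernat),
    [/\ internal f, hypernat_valued_function f, cut C
      & @vatom hypernat n @` A = vpreimage f C].

Definition hyperprime (p : hypernat) : Prop :=
  vmem (n := 0) p (star (inr [set q : nat | prime q] : superstr nat 1)).

Lemma hpiE (f g : I -> nat) :
  (\pi_hypernat f = \pi_hypernat g) <-> F [set i | f i = g i].
Proof. by split=> [/eqmodP/asboolP|h] //; apply/eqmodP/asboolP. Qed.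

Lemma repr_hpi (f : I -> nat) : F [set i | repr (\pi_hypernat f) i = f i].
Proof. by apply/hpiE; rewrite reprK. Qed.

Lemma hopE op (f g : I -> nat) :
  hop op (\pi_hypernat f) (\pi_hypernat g) =
  \pi_hypernat (fun i => op (f i) (g i)).
Proof.
apply/hpiE; apply: filterS2 (repr_hpi f) (repr_hpi g) => i /= -> -> //.
Qed.

Lemma repr_hop op (x y : hypernat) :
  F [set i | repr (hop op x y) i = op (repr x i) (repr y i)].
Proof. exact: repr_hpi. Qed.

Lemma hltE (f g : I -> nat) :
  hlt (\pi_hypernat f) (\pi_hypernat g) <-> F [set i | f i < g i].
Proof.
by split=> [/asboolP|] h; [|apply/asboolP];
  apply: filterS3 h (repr_hpi f) (repr_hpi g) => i /=;
  [move=> + <- <- | move=> + -> ->].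
Qed.

Lemma hyperprimeP (p : hypernat) :
  hyperprime p -> F [set i | prime (repr p i)].
Proof.
rewrite /hyperprime /star /=; case: asboolP => //= _ [g Fg ->].
by apply: filterS2 Fg (repr_hpi g) => i /= + ->.
Qed.

End Ultrapower.

Arguments hypernat {I} F {FU}.
Arguments std {I} F {FU} n.

(* The field { n | n < p } with the operations of *N taken modulo p. *)
Section Residues.
Context (I : Type) (F : set_system I) {FU : UltraFilter F}.
Variables (p : hypernat F) (hp : hyperprime p).

Definition hyperFp of hyperprime p := {x : hypernat F | hlt x p}.
Local Notation Fp := (hyperFp hp).

HB.instance Definition _ := [isSub of Fp for @sval _ (fun x => hlt x p)].
HB.instance Definition _ := [Choice of Fp by <:].

Lemma hmod_lt (x : hypernat F) : hlt (hop modn x p) p.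
Proof.
rewrite -[x]reprK -[p]reprK hopE; apply/hltE.
by apply: filterS (hyperprimeP hp) => i /= /prime_gt0; rewrite ltn_mod.
Qed.

Definition hmod (x : hypernat F) : Fp := exist _ (hop modn x p) (hmod_lt x).

Let FI (A B : set I) : F A -> F B -> F (A `&` B).
Proof. exact: filterI. Qed.

Let FS (A B : set I) : A `<=` B -> F A -> F B.
Proof. exact: filterS. Qed.

Definition fp_zero : Fp := hmod (std F 0).
Definition fp_one : Fp := hmod (std F 1).
Definition fp_add (x y : Fp) : Fp := hmod (hop addn (val x) (val y)).
Definition fp_opp (x : Fp) : Fp := hmod (hop subn p (val x)).
Definition fp_mul (x y : Fp) : Fp := hmod (hop muln (val x) (val y)).
Definition fp_inv (x : Fp) : Fp :=
  hmod (hop (fun a q => if a == 0 then 0 else (egcdn a q).1) (val x) p).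

Lemma fp_repr_lt (x : Fp) : F [set i | repr (val x) i < repr p i].
Proof. by case: x => x /= /asboolP. Qed.

(* Each operation, computed on representatives almost everywhere. *)
Lemma hmodE (x : hypernat F) :
  F [set i | repr (val (hmod x)) i = repr x i %% repr p i].
Proof. exact: repr_hpi. Qed.

Lemma fp_zeroE : F [set i | repr (val fp_zero) i = 0].
Proof.
apply: filterS2 (hmodE (std F 0)) (repr_hpi (fun=> 0)) => i /= -> ->.
by rewrite mod0n.
Qed.

Lemma fp_oneE : F [set i | repr (val fp_one) i = 1].
Proof.
apply: filterS3 (hmodE (std F 1)) (repr_hpi (fun=> 1)) (hyperprimeP hp) => i /= -> ->.
by move=> /prime_gt1 h; rewrite modn_small.
Qed.

Lemma fp_addE (x y : Fp) : F [set i | repr (val (fp_add x y)) i =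
  (repr (val x) i + repr (val y) i) %% repr p i].
Proof.
apply: filterS2 (hmodE (hop addn (val x) (val y)))
  (repr_hop addn (val x) (val y)) => i /= -> -> //.
Qed.

Lemma fp_oppE (x : Fp) : F [set i | repr (val (fp_opp x)) i =
  (repr p i - repr (val x) i) %% repr p i].
Proof.
apply: filterS2 (hmodE (hop subn p (val x)))
  (repr_hop subn p (val x)) => i /= -> -> //.
Qed.

Lemma fp_mulE (x y : Fp) : F [set i | repr (val (fp_mul x y)) i =
  (repr (val x) i * repr (val y) i) %% repr p i].
Proof.
apply: filterS2 (hmodE (hop muln (val x) (val y)))
  (repr_hop muln (val x) (val y)) => i /= -> -> //.
Qed.

Lemma fp_invE (x : Fp) : F [set i | repr (val (fp_inv x)) i =
  (if repr (val x) i == 0 then 0 else (egcdn (repr (val x) i) (repr p i)).1)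
    %% repr p i].
Proof.
apply: filterS2 (hmodE (hop (fun a q => if a == 0 then 0 else (egcdn a q).1) (val x) p))
  (repr_hop (fun a q => if a == 0 then 0 else (egcdn a q).1) (val x) p) => i /= -> -> //.
Qed.

Lemma fp_eqP (x y : Fp) :
  F [set i | repr (val x) i = repr (val y) i] -> x = y.
Proof. by move=> h; apply: val_inj; rewrite -[LHS]reprK -[RHS]reprK; apply/hpiE. Qed.

Lemma fp_addA : associative fp_add.
Proof.
move=> x y z; apply: fp_eqP.
have H := FI (fp_addE x (fp_add y z)) (FI (fp_addE (fp_add x y) z)
  (FI (fp_addE y z) (fp_addE x y))).
apply: FS H => i /= [-> [-> [-> ->]]].
by rewrite modnDml modnDmr addnA.
Qed.

Lemma fp_addC : commutative fp_add.
Proof.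
move=> x y; apply: fp_eqP; have H := FI (fp_addE x y) (fp_addE y x).
by apply: FS H => i /= [-> ->]; rewrite addnC.
Qed.

Lemma fp_add0 : left_id fp_zero fp_add.
Proof.
move=> x; apply: fp_eqP.
have H := FI (fp_addE fp_zero x) (FI fp_zeroE (fp_repr_lt x)).
by apply: FS H => i /= [-> [-> h]]; rewrite add0n modn_small.
Qed.

Lemma fp_addN : left_inverse fp_zero fp_opp fp_add.
Proof.
move=> x; apply: fp_eqP.
have H := FI (fp_addE (fp_opp x) x)
  (FI fp_zeroE (FI (fp_oppE x) (fp_repr_lt x))).
apply: FS H => i /= [-> [-> [-> h]]].
by rewrite modnDml subnK ?modnn // ltnW.
Qed.

HB.instance Definition _ :=
  GRing.isZmodule.Build Fp fp_addA fp_addC fp_add0 fp_addN.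

Lemma fp_mulA : associative fp_mul.
Proof.
move=> x y z; apply: fp_eqP.
have H := FI (fp_mulE x (fp_mul y z)) (FI (fp_mulE (fp_mul x y) z)
  (FI (fp_mulE y z) (fp_mulE x y))).
apply: FS H => i /= [-> [-> [-> ->]]].
by rewrite modnMml modnMmr mulnA.
Qed.

Lemma fp_mulC : commutative fp_mul.
Proof.
move=> x y; apply: fp_eqP; have H := FI (fp_mulE x y) (fp_mulE y x).
by apply: FS H => i /= [-> ->]; rewrite mulnC.
Qed.

Lemma fp_mul1 : left_id fp_one fp_mul.
Proof.
move=> x; apply: fp_eqP.
have H := FI (fp_mulE fp_one x) (FI fp_oneE (fp_repr_lt x)).
by apply: FS H => i /= [-> [-> h]]; rewrite mul1n modn_small.
Qed.

Lemma fp_mulD : left_distributive fp_mul fp_add.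
Proof.
move=> x y z; apply: fp_eqP.
have H := FI (fp_mulE (fp_add x y) z) (FI (fp_addE x y)
  (FI (fp_addE (fp_mul x z) (fp_mul y z))
    (FI (fp_mulE x z) (fp_mulE y z)))).
apply: FS H => i /= [-> [-> [-> [-> ->]]]].
by rewrite modnMml mulnDl modnDml modnDmr.
Qed.

Lemma fp_1neq0 : fp_one != fp_zero.
Proof.
apply/eqP => h; have H1 := fp_oneE; rewrite h in H1.
have [i /= [-> //]] := filter_ex (FI H1 fp_zeroE).
Qed.

HB.instance Definition _ :=
  GRing.Zmodule_isComNzRing.Build Fp fp_mulA fp_mulC fp_mul1 fp_mulD fp_1neq0.

Lemma fp_mulV (x : Fp) : x != 0%R -> fp_mul (fp_inv x) x = 1%R.
Proof.
move=> x0; apply: fp_eqP.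
have nz : F [set i | repr (val x) i != 0].
  have [//|h] := in_ultra_setVsetC [set i | repr (val x) i != 0] FU.
  case/eqP: x0; apply: fp_eqP; apply: filterS2 h fp_zeroE => i /=.
  by move=> /negP/negPn/eqP -> ->.
have H := FI (fp_mulE (fp_inv x) x) (FI fp_oneE (FI (fp_invE x)
  (FI (fp_repr_lt x) (FI nz (hyperprimeP hp))))).
apply: FS H => i /= [-> [-> [-> [xp [x0i pp]]]]].
rewrite (negPf x0i) modnMml; case: egcdnP => [|u v E _ /=]; first by rewrite lt0n.
have /eqP g1 : coprime (repr (val x) i) (repr p i).
  rewrite coprime_sym prime_coprime //; apply/negP => /dvdn_leq.
  by rewrite lt0n x0i leqNgt xp => /(_ isT).
by rewrite E g1 modnMDl modn_small // prime_gt1.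
Qed.

Lemma fp_inv0 : fp_inv 0%R = 0%R.
Proof.
apply: fp_eqP; have H := FI (fp_invE 0%R) fp_zeroE.
by apply: FS H => i /= [-> ->]; rewrite mod0n.
Qed.

HB.instance Definition _ :=
  GRing.ComNzRing_isField.Build Fp fp_mulV fp_inv0.

End Residues.

Local Open Scope ring_scope.
Local Open Scope card_scope.

Section Subfield.
Variables (K : fieldType) (S : divringClosed K).

Definition subfield := {x : K | x \in S}.

HB.instance Definition _ := [isSub of subfield for @sval _ (fun x => x \in S)].
HB.instance Definition _ := [Choice of subfield by <:].
HB.instance Definition _ := [SubChoice_isSubIntegralDomain of subfield by <:].
HB.instance Definition _ := [SubIntegralDomain_isSubField of subfield by <:].

End Subfield.

Section RealAlgebraic.
Variable R : realType.

Definition real_alg : {pred R} :=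
  fun x => `[< algebraicOver (ratr : rat -> R) x >].

Lemma real_alg_divring : divring_closed real_alg.
Proof.
split=> [|x y|x y]; rewrite /in_mem /=.
- by apply/asboolP; exact: algebraic1.
- by move=> /asboolP ? /asboolP ?; apply/asboolP; exact: algebraic_sub.
- by move=> /asboolP ? /asboolP ?; apply/asboolP; exact: algebraic_div.
Qed.

HB.instance Definition _ := GRing.isDivringClosed.Build R real_alg
  real_alg_divring.

End RealAlgebraic.

(* First-order formulas of the language of rings (hence no inverse or
   unit-test symbols) with parameters in A and free variables in V. *)
Fixpoint ring_term_over (K : fieldType) (A : set K) (V : set nat)
    (t : GRing.term K) : Prop :=
  match t with
  | GRing.Var i => V i
  | GRing.Const c => A c
  | GRing.NatConst _ => True
  | GRing.Add t1 t2 | GRing.Mul t1 t2 =>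
      ring_term_over A V t1 /\ ring_term_over A V t2
  | GRing.Opp t1 | GRing.NatMul t1 _ | GRing.Exp t1 _ => ring_term_over A V t1
  | GRing.Inv _ => False
  end.

Fixpoint ring_formula_over (K : fieldType) (A : set K) (V : set nat)
    (f : GRing.formula K) : Prop :=
  match f with
  | GRing.Bool _ => True
  | GRing.Equal t1 t2 => ring_term_over A V t1 /\ ring_term_over A V t2
  | GRing.Unit _ => False
  | GRing.And f1 f2 | GRing.Or f1 f2 | GRing.Implies f1 f2 =>
      ring_formula_over A V f1 /\ ring_formula_over A V f2
  | GRing.Not f1 => ring_formula_over A V f1
  | GRing.Exists i f1 | GRing.Forall i f1 => ring_formula_over A (i |` V) f1
  end.

(* Every finitely satisfiable 1-type (in the variable 'X_0) over a countable
   set of parameters is realized.  The order of a real closed field is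
   definable in the language of rings, so that the choice between rings and
   ordered rings is immaterial there. *)
Definition aleph1_saturated (K : fieldType) : Prop :=
  forall (A : set K) (Phi : set (GRing.formula K)),
    countable A ->
    (forall f, Phi f -> ring_formula_over A [set 0%N] f) ->
    (forall Psi : set (GRing.formula K), finite_set Psi -> Psi `<=` Phi ->
      exists x, forall f, Psi f -> GRing.holds [:: x] f) ->
    exists x, forall f, Phi f -> GRing.holds [:: x] f.

(* K carries an order making it a real closed field. *)
Definition real_closed (K : fieldType) : Prop :=
  exists (L : rcfType) (f : {rmorphism K -> L}), bijective f.

Definition continuum := [set: set nat].
Definition power_continuum := [set: set (set nat)].

Definition field_embeddings (K L : fieldType) : set (K -> L) :=
  [set f : K -> L | exists g : {rmorphism K -> L}, f = g].

Section Conclusion.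
Context (I : Type) (F : set_system I) {FU : UltraFilter F}.
Variables (p : hypernat F) (hp : hyperprime p).

Definition carrier (S : divringClosed (hyperFp hp)) : set (hypernat F) :=
  val @` [set x | x \in S].

Definition closed_delta_subfield (S : divringClosed (hyperFp hp)) : Prop :=
  [/\ almost_internal (carrier S), delta_set (carrier S),
      GRing.closed_field_axiom (subfield S)
    & continuum #<= [set: subfield S]].

Definition real_delta_subfield (S : divringClosed (hyperFp hp)) : Prop :=
  [/\ almost_internal (carrier S), delta_set (carrier S),
      real_closed (subfield S) & aleph1_saturated (subfield S)].

End Conclusion.

(* Main.v *)
From Stdlib Require List.
From HB Require Import structures.
From mathcomp Require Import all_boot all_order all_algebra generic_quotient.
From mathcomp Require Import polyrcf complex.
From mathcomp Require Import all_classical all_reals.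
From mathcomp Require Import ring lra.
Require Import Defs.

(* Let N be the field of real algebraic numbers if -1 is not a square, and its
   algebraic closure otherwise; N embeds into F_p.  Coordinatewise, the
   embedding is an injective partial morphism on all elements of N whose code
   is below some infinite d.  Iterating the Skolem bounds of all formulas gives
   a cut C below d, an intersection of countably many intervals, such that the
   elements of the ultrapower of N with code in C form an elementary
   substructure; its image in F_p is the required subfield.  Saturation follows
   from the overspill principle.

   For the embeddings of R into a field S of the given kind, fix a
   transcendence basis b of R; it has the cardinality of the continuum.  If S
   is algebraically closed, any injection of b into an independent family of S
   extends to R.  If S is real closed and saturated, every real is a standard
   part in S; any choice of lifts of b along the standard part extends to R by
   lifting simple roots, and each lift can be moved by an infinitesimal. *)

Set Implicit Arguments.
Unset Strict Implicit.
Unset Printing Implicit Defensive.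
Import Order.TTheory GRing.Theory Num.Theory.
Local Open Scope classical_set_scope.

(** * Infinite cardinals *)

Lemma chain_two (T : Type) (C : set (set T)) (x y : T) (X Y : set T) :
  total_on C subset -> C X -> C Y -> X x -> Y y ->
  exists Z, [/\ C Z, Z x & Z y].
Proof.
move=> tot CX CY Xx Yy; have [XY|YX] := tot _ _ CX CY.
  by exists Y; split=> //; exact: XY.
by exists X; split=> //; exact: YX.
Qed.

Lemma choice_in (T U : Type) (A : set T) (R : T -> U -> Prop) (u0 : U) :
  (forall x, A x -> exists y, R x y) ->
  exists f : T -> U, forall x, A x -> R x (f x).
Proof.
move=> h; have /choice[f fP] : forall x, exists y, A x -> R x y.
  move=> x; have [/h[y Ry]|nA] := pselect (A x); first by exists y.
  by exists u0.
by exists f.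
Qed.

(** A maximal graph of a partial injection between [A] and [B] is total on one side, since otherwise
    a pair of unmatched elements could be added. Empty types are split off because the functions
    must be defined on all of [T] or [U]. *)
Lemma card_comparable (T U : Type) (A : set T) (B : set U) :
  (exists2 f : T -> U, (forall x, A x -> B (f x)) &
     forall x y, A x -> A y -> f x = f y -> x = y) \/
  (exists2 g : U -> T, (forall y, B y -> A (g y)) &
     forall x y, B x -> B y -> g x = g y -> x = y).
Proof.
have [[x0]|T0] := pselect (inhabited T); last first.
  have [[y0]|U0] := pselect (inhabited U); last first.
    right; exists (fun y => False_rect _ (U0 (inhabits y))) => [y|y]; by case: U0.
  by left; exists (fun=> y0) => [x|x]; case: T0.
have [[y0]|U0] := pselect (inhabited U); last first.
  by right; exists (fun=> x0) => [x|x]; case: U0.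
pose P (G : set (T * U)) := [/\ forall z, G z -> A z.1 /\ B z.2,
  forall z w, G z -> G w -> z.1 = w.1 -> z = w &
  forall z w, G z -> G w -> z.2 = w.2 -> z = w].
have [C CP tot|G [[GAB Gf Gi] Gmax]] := @Zorn_bigcup _ P.
  split=> [z [X CX Xz]|z w [X CX Xz] [Y CY Yw]|z w [X CX Xz] [Y CY Yw]].
  - by have [h _ _] := CP _ CX; exact: h.
  - have [Z [CZ Zz Zw]] := chain_two tot CX CY Xz Yw.
    by have [_ h _] := CP _ CZ; exact: h.
  - have [Z [CZ Zz Zw]] := chain_two tot CX CY Xz Yw.
    by have [_ _ h] := CP _ CZ; exact: h.
have [Adom|/existsNP[a /not_implyP[Aa aG]]] :=
    pselect (forall x, A x -> exists y, G (x, y)).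
  have [f fG] := choice_in y0 Adom; left; exists f => [x /fG/GAB[]//|x x'].
  by move=> /fG Gx /fG Gx' E; have [] := Gi _ _ Gx Gx' E.
have [Bdom|/existsNP[b /not_implyP[Bb bG]]] :=
    pselect (forall y, B y -> exists x, G (x, y)).
  have [f fG] := choice_in x0 Bdom; right; exists f => [y /fG/GAB[]//|y y'].
  by move=> /fG Gy /fG Gy' E; have [] := Gf _ _ Gy Gy' E.
exfalso; apply: (Gmax (G `|` [set (a, b)])).
  split=> [z|/(_ (a, b))]; first by left.
  by move=> /(_ (or_intror erefl)) Gab; apply: aG; exists b.
split=> [z [/GAB//|->]//|z w [Gz|->] [Gw|->]|z w [Gz|->] [Gw|->]] //=.
- exact: Gf.
- by case: z Gz => x y /= ? E; subst x; case: aG; exists y.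
- by case: w Gw => x y /= ? E; subst x; case: aG; exists y.
- exact: Gi.
- by case: z Gz => x y /= ? E; subst y; case: bG; exists x.
- by case: w Gw => x y /= ? E; subst y; case: bG; exists x.
Qed.

(* Hessenberg: the complement of a maximal subset [A] carrying an injection
   from [A * A] to [A] embeds into [A]. *)
Lemma infinite_pairing (J : Type) (i : nat -> J) : injective i ->
  exists f : J -> J -> J, forall a b c d, f a b = f c d -> a = c /\ b = d.
Proof.
move=> iI.
pose dom (G : set (J * J * J)) a := exists c, G (a, a, c).
pose Q (G : set (J * J * J)) := [/\ 
  forall p c c', G (p, c) -> G (p, c') -> c = c',
  forall p p' c, G (p, c) -> G (p', c) -> p = p',
  forall a b c, G (a, b, c) -> [/\ dom G a, dom G b & dom G c] &
  forall a b, dom G a -> dom G b -> exists c, G (a, b, c)].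
pose G0 : set (J * J * J) :=
  [set z | exists m n, z = (i m, i n, i (pickle (m, n)))].
have domS G G' a : G `<=` G' -> dom G a -> dom G' a.
  by move=> GG' [c Gc]; exists c; exact: GG'.
have QG0 : Q G0.
  have dG0 n : dom G0 (i n) by exists (i (pickle (n, n))); exists n, n.
  split.
  - move=> p c c' [m [n [-> ->]]] [m' [n' [Em En ->]]].
    by rewrite (iI _ _ Em) (iI _ _ En).
  - move=> p p' c [m [n [-> ->]]] [m' [n' [-> /iI E]]].
    by have [-> ->] := pcan_inj pickleK E.
  - by move=> a b c [m [n [-> -> ->]]]; split; exact: dG0.
  - move=> a b [_ [m [n [-> _ _]]]] [_ [m' [n' [-> _ _]]]].
    by exists (i (pickle (m, m'))), m, m'.
(* The union with [G0] lets the empty chain through Zorn's lemma and keeps the range of [i] inside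
   the domain of the maximal graph. *)
have [C CP tot|G [QG Gmax]] := @Zorn_bigcup _ (fun G => Q (G `|` G0)).
  have [->|/set0P[X0 CX0]] := eqVneq C set0; first by rewrite bigcup_set0 set0U.
  have two x y : ((\bigcup_(X in C) X) `|` G0) x ->
      ((\bigcup_(X in C) X) `|` G0) y ->
      exists X, [/\ C X, (X `|` G0) x & (X `|` G0) y].
    move=> [[X CX Xx]|G0x] [[Y CY Yy]|G0y].
    - have [Z [CZ Zx Zy]] := chain_two tot CX CY Xx Yy.
      by exists Z; split=> //; left.
    - by exists X; split=> //; [left|right].
    - by exists Y; split=> //; [right|left].
    - by exists X0; split=> //; right.
  have sub X : C X -> X `|` G0 `<=` (\bigcup_(X in C) X) `|` G0.
    by move=> CX z [Xz|]; [left; exists X|right].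
  split.
  - move=> p c c' h h'; have [X [CX Xc Xc']] := two _ _ h h'.
    by have [q _ _ _] := CP _ CX; exact: q Xc Xc'.
  - move=> p p' c h h'; have [X [CX Xc Xc']] := two _ _ h h'.
    by have [_ q _ _] := CP _ CX; exact: q Xc Xc'.
  - move=> a b c h; have [X [CX Xc _]] := two _ _ h h.
    have [_ _ q _] := CP _ CX; have [da db dc] := q _ _ _ Xc.
    by split; apply: (domS _ _ _ (sub _ CX)).
  - move=> a b [c h] [c' h']; have [X [CX Xc Xc']] := two _ _ h h'.
    have [_ _ _ q] := CP _ CX.
    have [e Xe] : exists e, (X `|` G0) (a, b, e) by apply: q; eexists; eassumption.
    by exists e; exact: sub Xe.
move: QG Gmax; set H := G `|` G0 => -[Hf Hi Hd Ht] Gmax.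
have [f fP] : exists f, forall a b, dom H a -> dom H b -> H (a, b, f a b).
  have [|g gP] := @choice_in _ _ [set p | dom H p.1 /\ dom H p.2]
      (fun p c => H (p.1, p.2, c)) (i 0).
    by move=> [a b] [da db]; exact: Ht.
  by exists (fun a b => g (a, b)) => a b da db; exact: (gP (a, b)).
have fd a b : dom H a -> dom H b -> dom H (f a b).
  by move=> da db; have [_ _] := Hd _ _ _ (fP _ _ da db).
have fI a b c d : dom H a -> dom H b -> dom H c -> dom H d ->
    f a b = f c d -> a = c /\ b = d.
  move=> da db dc dd E; have := fP _ _ da db; rewrite E => h.
  by have [-> ->] := Hi _ _ _ h (fP _ _ dc dd).
have di n : dom H (i n).
  by exists (i (pickle (n, n))); right; exists n, n.
have [[l lB lI]|[k kA kI]] := card_comparable (dom H) (~` dom H); last first.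
  (* The tags [i 0] and [i 1] place the domain and its complement disjointly inside the domain, so
     all of [J] embeds into it. *)
  pose k' x := if pselect (dom H x) then f (i 0) x else f (i 1) (k x).
  have dk' x : dom H (k' x).
    by rewrite /k'; case: pselect => ?; apply: fd => //; exact: kA.
  have k'I : injective k'.
    move=> x y; rewrite /k'; case: pselect => dx; case: pselect => dy E.
    - by case: (fI _ _ _ _ _ _ _ _ E).
    - by case: (fI _ _ _ _ _ _ _ _ E) => //; [exact: kA|move=> /iI].
    - by case: (fI _ _ _ _ _ _ _ _ E) => //; [exact: kA|move=> /iI].
    - by apply: kI => //; case: (fI _ _ _ _ _ _ _ _ E) => //; exact: kA.
  exists (fun x y => f (k' x) (k' y)) => a b c d E.
  by case: (fI _ _ _ _ _ _ _ _ E) => // /k'I -> /k'I ->.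
(* Otherwise [l] copies the domain of [H] into its complement, and [H]
   extends to the union of both. *)
exfalso.
pose val (t : bool) x := if t then l x else x.
(* Pairs with a copied coordinate go into the copy; one of four distinct tags records which
   coordinates are copied, so that the values stay apart. *)
pose tag (s t : bool) := i (s + t.*2)%N.
pose N : set (J * J * J) := [set z | exists s t x y,
  [/\ s || t, dom H x, dom H y & z = (val s x, val t y, l (f (tag s t) (f x y)))]].
have valI s t x y : dom H x -> dom H y -> val s x = val t y -> s = t /\ x = y.
  move=> dx dy; case: s; case: t => //= E.
  - by split=> //; apply: lI.
  - by have := lB _ dx; rewrite E.
  - by have := lB _ dy; rewrite -E.
have dn s t x y : dom H x -> dom H y -> dom H (f (tag s t) (f x y)).
  by move=> dx dy; apply: (fd); [exact: di|exact: fd].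
have HN a b c s t x y : H (a, b, c) -> s || t -> dom H x -> dom H y ->
    (a, b) = (val s x, val t y) -> False.
  move=> /Hd[da db _] st dx dy [Ea Eb]; case: s Ea st => /= Ea.
    by case: (lB _ dx); rewrite -Ea.
  by move=> tt; move: Eb; rewrite tt /= => Eb; case: (lB _ dy); rewrite -Eb.
have dom' s x : dom H x -> dom (H `|` N) (val s x).
  move=> dx; case: s; last by apply: domS dx => z; left.
  by exists (l (f (tag true true) (f x x))); right; exists true, true, x, x.
have dom'P z : dom (H `|` N) z -> exists s x, dom H x /\ z = val s x.
  move=> [c [/Hd[dz _ _]|[s [t [x [y [_ dx dy [-> _]]]]]] _]].
    by exists false, z.
  by exists s, x.
apply: (Gmax (H `|` N)).
  split; first by move=> z Gz; left; left.
  move=> /(_ (l (i 0), l (i 0), l (f (tag true true) (f (i 0) (i 0))))).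
  have Nz : N (l (i 0), l (i 0), l (f (tag true true) (f (i 0) (i 0)))).
    by exists true, true, (i 0), (i 0).
  move=> /(_ (or_intror Nz)) Gz; have Hz : dom H (l (i 0)).
    by have [] := Hd _ _ _ (or_introl Gz).
  exact: lB (di 0) Hz.
have -> : H `|` N `|` G0 = H `|` N.
  by apply/seteqP; split=> z; [move=> [//|?]; left; right|left].
split.
- move=> [a b] c c' [h|[s [t [x [y [st dx dy [Ea Eb Ec]]]]]]].
    move=> [h'|[s [t [x [y [st dx dy [Ea Eb Ec]]]]]]]; first exact: Hf h h'.
    by case: (HN _ _ _ _ _ _ _ h st dx dy); rewrite Ea Eb.
  move=> [h'|[s' [t' [x' [y' [st' dx' dy' [Ea' Eb' Ec']]]]]]].
    by case: (HN _ _ _ _ _ _ _ h' st dx dy); rewrite Ea Eb.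
  have [ss xx] : s = s' /\ x = x' by apply: valI => //; rewrite -Ea -Ea'.
  have [tt yy] : t = t' /\ y = y' by apply: valI => //; rewrite -Eb -Eb'.
  by rewrite Ec Ec' ss tt xx yy.
- move=> p p' c [h|[s [t [x [y [st dx dy [-> Ec]]]]]]].
    move=> [h'|[s [t [x [y [st dx dy [Ep Ec]]]]]]]; first exact: Hi h h'.
    case: p h => a b /Hd[_ _]; rewrite Ec => dl.
    by case: (lB _ (dn s t x y dx dy)).
  move=> [h'|[s' [t' [x' [y' [st' dx' dy' [-> Ec']]]]]]].
    case: p' h' => a b /Hd[_ _]; rewrite Ec => dl.
    by case: (lB _ (dn s t x y dx dy)).
  have E : f (tag s t) (f x y) = f (tag s' t') (f x' y').
    by apply: lI; [exact: dn|exact: dn|rewrite -Ec -Ec'].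
  have [|||| Et Ef] := fI _ _ _ _ _ _ _ _ E; try exact: di; try exact: fd.
  have [-> ->] := fI _ _ _ _ dx dy dx' dy' Ef.
  have {Et} := iI _ _ Et.
  by case: s s' t t' {st st' E Ec Ec'} => -[] [] [].
- move=> a b c [/Hd[da db dc]|[s [t [x [y [st dx dy [-> -> ->]]]]]]].
    by split; exact: (dom' false).
  by split; [exact: dom'|exact: dom'|apply: (dom' true); exact: dn].
- move=> a b /dom'P[s [x [dx ->]]] /dom'P[t [y [dy ->]]].
  case: (boolP (s || t)) => st.
    by exists (l (f (tag s t) (f x y))); right; exists s, t, x, y.
  move: st; rewrite negb_or => /andP[/negPf -> /negPf ->] /=.
  by exists (f x y); left; exact: fP.
Qed.

Local Open Scope quotient_scope.
Local Open Scope ring_scope.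
Local Open Scope card_scope.

(** * Algebraic independence *)

(** Integer polynomials in arbitrarily many variables, kept as syntax so that they can be coded
    injectively and can also serve as the terms of first-order formulas. *)
Inductive pexp (J : Type) : Type :=
  | PVar of J
  | PNat of nat
  | POpp of pexp J
  | PAdd of pexp J & pexp J
  | PMul of pexp J & pexp J.

Arguments PNat {J}.

Fixpoint peval (J : Type) (K : nzRingType) (v : J -> K) (p : pexp J) : K :=
  match p with
  | PVar j => v j
  | PNat n => n%:R
  | POpp q => - peval v q
  | PAdd q r => peval v q + peval v r
  | PMul q r => peval v q * peval v r
  end.

Fixpoint pvars (J : Type) (p : pexp J) : set J :=
  match p with
  | PVar j => [set j]
  | PNat _ => set0
  | POpp q => pvars q
  | PAdd q r | PMul q r => pvars q `|` pvars r
  end.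

Fixpoint psubst (J L : Type) (s : J -> pexp L) (p : pexp J) : pexp L :=
  match p with
  | PVar j => s j
  | PNat n => PNat n
  | POpp q => POpp (psubst s q)
  | PAdd q r => PAdd (psubst s q) (psubst s r)
  | PMul q r => PMul (psubst s q) (psubst s r)
  end.

Definition update (J T : Type) (v : J -> T) (j : J) (x : T) : J -> T :=
  fun k => if pselect (k = j) then x else v k.

Lemma update_eq (J T : Type) (v : J -> T) j x : update v j x j = x.
Proof. by rewrite /update; case: pselect. Qed.

Lemma update_neq (J T : Type) (v : J -> T) j x k : k <> j -> update v j x k = v k.
Proof. by rewrite /update; case: pselect. Qed.

Lemma update_id (J T : Type) (v : J -> T) j : update v j (v j) = v.
Proof. by apply/funext => k; rewrite /update; case: pselect => //= E; rewrite E. Qed.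

Section PolynomialExpressions.
Variable J : Type.

Lemma peval_ext (K : nzRingType) (v w : J -> K) (p : pexp J) :
  (forall j, pvars p j -> v j = w j) -> peval v p = peval w p.
Proof.
elim: p => [j|n|q IH|q IHq r IHr|q IHq r IHr] //= E.
- exact: E.
- by rewrite IH.
- by rewrite IHq ?IHr // => j ?; apply: E; [right|left].
- by rewrite IHq ?IHr // => j ?; apply: E; [right|left].
Qed.

Lemma peval_morph (K L : nzRingType) (f : {rmorphism K -> L}) (v : J -> K) p :
  f (peval v p) = peval (f \o v) p.
Proof.
elim: p => [j|n|q IH|q IHq r IHr|q IHq r IHr] //=.
- by rewrite rmorph_nat.
- by rewrite rmorphN IH.
- by rewrite rmorphD IHq IHr.
- by rewrite rmorphM IHq IHr.
Qed.

Lemma peval_subst (L : Type) (K : nzRingType) (v : L -> K) (s : J -> pexp L) p :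
  peval v (psubst s p) = peval (fun j => peval v (s j)) p.
Proof. by elim: p => //= [q ->|q -> r ->|q -> r ->]. Qed.

Lemma pvars_subst (L : Type) (s : J -> pexp L) (p : pexp J) k :
  pvars (psubst s p) k -> exists2 j, pvars p j & pvars (s j) k.
Proof.
elim: p => //= [j ?|q IHq r IHr|q IHq r IHr]; first by exists j.
- by move=> [/IHq|/IHr] [j]; exists j => //; [left|right].
- by move=> [/IHq|/IHr] [j]; exists j => //; [left|right].
Qed.

(* [p] vanishes at all natural points, i.e. denotes the zero polynomial. *)
Definition pnull (p : pexp J) : Prop :=
  forall z : J -> nat, peval (fun j => (z j)%:R : int) p = 0.

Lemma natr_inj_char0 (K : nzRingType) :
  (forall n, (n%:R == 0 :> K) = (n == 0)%N) -> injective (fun n : nat => n%:R : K).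
Proof.
move=> ch0 m n; wlog le : m n / (m <= n)%N.
  by move=> W E; case/orP: (leq_total m n) => /W; [apply|move=> <-].
move=> /esym/eqP; rewrite -subr_eq0 -natrB // ch0 subn_eq0 => nm.
by apply/eqP; rewrite eqn_leq le nm.
Qed.

Lemma natroots_poly0 (K : idomainType) (P : {poly K}) :
  (forall n, (n%:R == 0 :> K) = (n == 0)%N) ->
  (forall n : nat, P.[n%:R] = 0) -> P = 0.
Proof.
move=> ch0 P0; apply/eqP; apply: contraT => Pn0.
have := max_poly_roots Pn0 (rs := [seq n%:R | n <- iota 0 (size P)]).
rewrite size_map size_iota ltnn; apply.
  by apply/allP => _ /mapP[n _ ->]; apply/rootP.
by rewrite map_inj_uniq ?iota_uniq //; exact: natr_inj_char0.
Qed.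

(** The variables are freed one at a time: with the others fixed, [p] is a polynomial in one of them
    that vanishes at all natural numbers, hence everywhere in characteristic 0. The induction is on
    a list containing the variables whose values are not known to be natural numbers. *)
Lemma pnull_eval (K : idomainType) (v : J -> K) (p : pexp J) :
  (forall n, (n%:R == 0 :> K) = (n == 0)%N) -> pnull p -> peval v p = 0.
Proof.
move=> ch0 p0.
have [s] : exists s : seq J, forall j, pvars p j -> List.In j s.
  elim: p {p0} => [j|n|q IH|q [s IHq] r [t IHr]|q [s IHq] r [t IHr]] /=.
  - by exists [:: j] => _ ->; left.
  - by exists [::].
  - by [].
  - by exists (s ++ t) => j [/IHq|/IHr] ?; apply/List.in_or_app; [left|right].
  - by exists (s ++ t) => j [/IHq|/IHr] ?; apply/List.in_or_app; [left|right].
move=> sP; have {sP} : forall j, pvars p j -> List.In j s \/ exists m, v j = m%:R.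
  by move=> j /sP; left.
elim: s v => [|j s IH] v vs.
  have /(@choice_in _ _ _ _ 0%N)[z zP] : forall j, pvars p j -> exists m, v j = m%:R.
    by move=> j /vs[].
  rewrite (peval_ext (w := intr \o (fun j => (z j)%:R : int))); last first.
    by move=> j /zP -> /=; rewrite rmorph_nat.
  by rewrite -peval_morph p0 rmorph0.
pose P : {poly K} := peval (update (fun k => (v k)%:P) j 'X) p.
have PE x : P.[x] = peval (update v j x) p.
  rewrite -[LHS]/(horner_eval x P) peval_morph; congr (peval _ p).
  by apply/funext => k; rewrite /= /update /horner_eval; case: pselect => ?;
    rewrite ?hornerX ?hornerC.
have P0 : P = 0.
  apply: natroots_poly0 => // n; rewrite PE; apply: IH => k /vs pk.
  rewrite /update; case: pselect => [e|nkj] /=; first by right; exists n.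
  by case: pk => [[/esym//|ks]|?]; [left|right].
by have := PE (v j); rewrite P0 horner0 update_id.
Qed.

Lemma pexp_code (M : Type) (i : J -> M) (tag : nat -> M) (pr : M -> M -> M) :
  injective i -> injective tag ->
  (forall a b c d, pr a b = pr c d -> a = c /\ b = d) ->
  exists c : pexp J -> M, injective c.
Proof.
move=> iI tI prI.
exists (fix c p := match p with
  | PVar j => pr (tag 0) (i j)
  | PNat n => pr (tag 1) (tag n)
  | POpp q => pr (tag 2) (c q)
  | PAdd q r => pr (tag 3) (pr (c q) (c r))
  | PMul q r => pr (tag 4) (pr (c q) (c r)) end)%N.
elim=> [j|n|q IH|q IHq r IHr|q IHq r IHr] [j'|n'|q'|q' r'|q' r'];
  move=> /prI[/tI//= _].
- by move=> /iI ->.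
- by move=> /tI ->.
- by move=> /IH ->.
- by move=> /prI[/IHq -> /IHr ->].
- by move=> /prI[/IHq -> /IHr ->].
Qed.

End PolynomialExpressions.

Definition independent (J : Type) (K : nzRingType) (x : J -> K) : Prop :=
  forall p : pexp J, peval x p = 0 -> pnull p.

Lemma extend_along (J L T : Type) (h : L -> J) (z : L -> T) (t0 : T) :
  injective h -> exists z' : J -> T, z' \o h = z.
Proof.
move=> hI.
have [|z' z'P] := @choice_in J T (range h) (fun j t => forall l, h l = j -> z l = t) t0.
  by move=> _ [l _ <-]; exists (z l) => k /hI ->.
by exists z'; apply/funext => l /=; symmetry; apply: z'P => //; exists l.
Qed.

Lemma independent_comp (J L : Type) (K : nzRingType) (x : J -> K) (h : L -> J) :
  injective h -> independent x -> independent (x \o h).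
Proof.
move=> hI xind p px z; have [z' <-] := extend_along z 0%N hI.
have : peval x (psubst (@PVar _ \o h) p) = 0 by rewrite peval_subst.
by move=> /xind /(_ z'); rewrite peval_subst.
Qed.

(** The coefficients are polynomials in the family, which is no restriction after clearing
    denominators; a finite list of expressions then determines [y] up to finitely many choices. *)
Definition algebraic_over_family (J : Type) (K : nzRingType) (x : J -> K) y :=
  exists qs : seq (pexp J),
    Poly [seq peval x q | q <- qs] != 0 /\ root (Poly [seq peval x q | q <- qs]) y.

Lemma eq_exist_inj (T : Type) (P : T -> Prop) : injective (@proj1_sig T P).
Proof. by move=> [x Px] [y Py] /= E; apply: eq_exist. Qed.

Lemma intr_eq0_char0 (K : nzRingType) (m : int) :
  (forall n, (n%:R == 0 :> K) = (n == 0)%N) -> m%:~R = 0 :> K -> m = 0.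
Proof.
move=> ch0; case: m => n.
  by rewrite -pmulrn => /eqP; rewrite ch0 => /eqP ->.
by rewrite NegzE rmorphN /= -pmulrn => /eqP; rewrite oppr_eq0 ch0.
Qed.

(** Independence is first phrased for expressions whose variables are field elements; since an
    expression has finitely many variables, it passes to unions of chains. For [y] outside a maximal
    set, a nontrivial relation involving [y] is read as a polynomial in [y]. *)
Lemma transcendence_basis (K : fieldType) :
  (forall n, (n%:R == 0 :> K) = (n == 0)%N) ->
  exists (B : set K), independent (@proj1_sig K B) /\
    forall y, algebraic_over_family (@proj1_sig K B) y.
Proof.
move=> ch0.
pose ind (B : set K) := forall p : pexp K, pvars p `<=` B -> peval id p = 0 -> pnull p.
have [C CP tot|B [indB Bmax]] := @Zorn_bigcup _ ind.
  have [->|/set0P[X0 CX0]] := eqVneq C set0.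
    (* The empty chain: an expression without variables denotes an integer, and in characteristic 0
       an integer that vanishes in [K] is zero. *)
    rewrite bigcup_set0 => p p0 pe z.
    apply: (intr_eq0_char0 ch0); rewrite peval_morph -[RHS]pe.
    by apply: peval_ext => j /p0.
  move=> p pC; have [X [CX pX]] : exists X, C X /\ pvars p `<=` X.
    elim: p pC => [j|n|q IH|q IHq r IHr|q IHq r IHr] /= sC.
    - by have [X CX Xj] := sC j erefl; exists X; split=> // _ ->.
    - by exists X0; split=> [|j []].
    - exact: (IH sC).
    - have [|X [CX qX]] := IHq; first by move=> j qj; apply: sC; left.
      have [|Y [CY rY]] := IHr; first by move=> j qj; apply: sC; right.
      have [XY|YX] := tot _ _ CX CY.
        by exists Y; split=> // j [/qX/XY|/rY].
      by exists X; split=> // j [/qX|/rY/YX].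
    - have [|X [CX qX]] := IHq; first by move=> j qj; apply: sC; left.
      have [|Y [CY rY]] := IHr; first by move=> j qj; apply: sC; right.
      have [XY|YX] := tot _ _ CX CY.
        by exists Y; split=> // j [/qX/XY|/rY].
      by exists X; split=> // j [/qX|/rY/YX].
  exact: (CP _ CX).
exists B; split.
  move=> p pe z; have [z' <-] := extend_along z 0%N (@eq_exist_inj K B).
  have : pnull (psubst (@PVar _ \o @proj1_sig K B) p).
    apply: indB; last by rewrite peval_subst.
    by move=> k h; have [[j Bj] _ /= ->] := pvars_subst h.
  by move=> /(_ z'); rewrite peval_subst.
move=> y; have [By|nBy] := pselect (B y).
  exists [:: POpp (PVar (exist B y By)); PNat 1] => /=.
  rewrite !cons_poly_def mul0r add0r polyC1 mul1r polyCN /root.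
  by rewrite -lead_coef_eq0 lead_coefXsubC oner_eq0 !hornerE subrr.
have [p [pB p0 pn]] : exists p : pexp K,
    [/\ pvars p `<=` B `|` [set y], peval id p = 0 & ~ pnull p].
  have : ~ ind (B `|` [set y]).
    apply: Bmax; split=> [z|/(_ y)]; first by left.
    by move=> /(_ (or_intror erefl)).
  move=> /existsNP[p /not_implyP[pB /not_implyP[p0 pn]]].
  by exists p.
pose v : K -> {poly K} := update polyC y 'X.
pose ZB (c : K) := exists q : pexp {x | B x}, c = peval (@proj1_sig K B) q.
have ZB0 : ZB 0 by exists (PNat 0).
have ZBD a b : ZB a -> ZB b -> ZB (a + b).
  by move=> [q ->] [r ->]; exists (PAdd q r).
have ZBM a b : ZB a -> ZB b -> ZB (a * b).
  by move=> [q ->] [r ->]; exists (PMul q r).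
have ZBn n : ZB n%:R by exists (PNat n).
have fZB i : ZB (peval v p)`_i.
  move: pB i {p0 pn}; elim: p => [j|n|q IH|q IHq r IHr|q IHq r IHr] /= sB i.
  - rewrite /v /update; case: pselect => [e|jy] /=; first by rewrite coefX; exact: ZBn.
    rewrite coefC; case: eqP => _ //.
    have [Bj|] := sB j erefl; last by [].
    by exists (PVar (exist B j Bj)).
  - by rewrite -polyC_natr coefC; case: eqP.
  - by rewrite coefN; have [r ->] := IH sB i; exists (POpp r).
  - rewrite coefD; apply: ZBD.
      by apply: IHq => j qj; apply: sB; left.
    by apply: IHr => j qj; apply: sB; right.
  - rewrite coefM; apply: (big_ind ZB) => // j _; apply: ZBM.
      by apply: IHq => k qj; apply: sB; left.
    by apply: IHr => k qj; apply: sB; right.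
have vE x : (peval v p).[x] = peval (update id y x) p.
  rewrite -[LHS]/(horner_eval x _) peval_morph; congr (peval _ p).
  by apply/funext => k; rewrite /= /v /update /horner_eval; case: pselect => ?;
    rewrite ?hornerX ?hornerC.
have [qs qsE] : exists qs, peval v p = Poly [seq peval (@proj1_sig K B) q | q <- qs].
  have /choice[c cE] := fZB.
  exists (mkseq c (size (peval v p))); apply/polyP => i; rewrite coef_Poly.
  have [lt|ge] := ltnP i (size (peval v p)).
    by rewrite (nth_map (PNat 0)) ?size_mkseq // nth_mkseq // cE.
  by rewrite !nth_default // size_map size_mkseq.
exists qs; rewrite -qsE; split; last first.
  by rewrite /root vE; rewrite (_ : update id y y = id) ?p0 // -[RHS](update_id _ y).
(* If all coefficients vanished, replacing [y] by any natural number would give a relation over [B]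
   alone, so [p] would be null. *)
apply/eqP => f0; apply: pn => z.
have : pnull (psubst (update (@PVar K) y (PNat (z y))) p).
  apply: indB => [k h|]; first have [j /pB] := pvars_subst h.
    rewrite /update; case: pselect => //= jy [Bj|//] ->; exact: Bj.
  rewrite peval_subst -[RHS](horner0 (z y)%:R) -f0 vE; apply: peval_ext => j _.
  by rewrite /update; case: pselect.
move=> /(_ z); rewrite peval_subst => <-; apply: peval_ext => j _.
by rewrite /update; case: pselect => [e|] /=; rewrite ?e.
Qed.

Lemma roots_seq (K : fieldType) (f : {poly K}) :
  f != 0 -> exists rs : seq K, forall y, root f y -> y \in rs.
Proof.
have [n] := ubnP (size f); elim: n f => // n IH f sf f0.
have [[x fx]|nf] := pselect (exists x, root f x); last first.
  by exists [::] => y fy; case: nf; exists y.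
have [g fE] := factor_theorem _ _ fx.
have g0 : g != 0 by apply: contraNneq f0 => g0; rewrite fE g0 mul0r.
have [|//|rs rsP] := IH g.
  by move: sf; rewrite fE size_mul ?polyXsubC_eq0 // size_XsubC addn2.
exists (x :: rs) => y; rewrite fE rootM root_XsubC inE orbC.
by move=> /orP[->//|/rsP ->]; rewrite orbT.
Qed.

(** An element is determined by the expressions of its coefficients and by its index in a list of
    the roots; the product built by [foldr] spells out both. *)
Lemma algebraic_code (J : Type) (K : fieldType) (x : J -> K) :
  (forall y, algebraic_over_family x y) -> exists c : K -> pexp J, injective c.
Proof.
move=> alg; have /choice[qs qsP] := alg.
pose f y := Poly [seq peval x q | q <- qs y].
have /choice[rs rsP] : forall f : {poly K}, exists rs : seq K,
    f != 0 -> forall y, root f y -> y \in rs.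
  move=> g; have [->|g0] := eqVneq g 0; first by exists [::].
  by have [rs ?] := roots_seq g0; exists rs.
exists (fun y => foldr (@PMul J) (PNat (index y (rs (f y)))) (qs y)) => y z E.
have [fy0 fy] := qsP y; have [fz0 fz] := qsP z.
have [qE iE] : qs y = qs z /\ index y (rs (f y)) = index z (rs (f z)).
  move: (index y _) (index z _) (qs y) (qs z) E {fy0 fy fz0 fz} => m n.
  elim=> [|a s IH] [|b t] //=; first by case.
  by move=> [-> /IH[-> ->]].
have yin := rsP _ fy0 _ fy; have zin := rsP _ fz0 _ fz.
rewrite -(nth_index 0 yin) -(nth_index 0 zin).
by move: iE; rewrite /f qE => ->.
Qed.

Lemma cantor_nat (f : set nat -> nat) : ~ injective f.
Proof.
move=> fI; pose D := [set n | exists2 A, f A = n & ~ A n].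
have nD : ~ D (f D) by move=> h; case: (h) => A /fI ->; exact.
by apply: (nD); exists D.
Qed.

(** The field injects into the expressions over a transcendence basis. Over an infinite basis,
    pairing codes these expressions by basis elements, so the basis is as large as [c] requires.
    Without an injection of the natural numbers the basis embeds into them, the expressions are
    countable, and Cantor's theorem is contradicted. *)
Lemma big_independent_family (K : fieldType) (c : set nat -> K) :
  (forall n, (n%:R == 0 :> K) = (n == 0)%N) -> injective c ->
  exists (J : Type) (x : J -> K) (i : set nat -> J),
    [/\ injective i, injective x, independent x &
      forall y, algebraic_over_family x y].
Proof.
move=> ch0 cI; have [B [indB algB]] := transcendence_basis ch0.
have [k kI] := algebraic_code algB.
have [[i iI]|ni] := pselect (exists i : nat -> {x | B x}, injective i).
  have [pr prI] := infinite_pairing iI.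
  have [d dI] := pexp_code (@inj_id _) iI prI.
  exists {x | B x}, (@proj1_sig K B), (d \o k \o c); split=> //.
    exact: inj_comp (inj_comp dI kI) cI.
  exact: eq_exist_inj.
exfalso; have [[g _ gI]|[g _ gI]] := @card_comparable nat {x | B x} setT setT.
  by apply: ni; exists g => a b; exact: gI.
have [pr prI] := infinite_pairing (@inj_id nat).
have gI' : injective g by move=> a b; exact: gI.
have [d dI] := pexp_code gI' (@inj_id nat) prI.
by apply: (@cantor_nat (d \o k \o c)); exact: inj_comp (inj_comp dI kI) cI.
Qed.

(** * Extending field embeddings *)

Definition field_graph (R S : fieldType) (G : set (R * S)) : Prop :=
  [/\ G (1, 1),
    forall x s y t, G (x, s) -> G (y, t) -> G (x - y, s - t),
    forall x s y t, G (x, s) -> G (y, t) -> G (x * y, s * t) &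
    forall x s, G (x, s) -> G (x^-1, s^-1)].

(* The graph of the inverse of a place: nonzero elements may be matched with [0]. *)
Definition place_graph (R S : fieldType) (V : set (R * S)) : Prop :=
  [/\ V (1, 1),
    forall x s y t, V (x, s) -> V (y, t) -> V (x - y, s - t),
    forall x s y t, V (x, s) -> V (y, t) -> V (x * y, s * t) &
    forall x s, x != 0 -> V (x, s) -> V (x^-1, s^-1)].

Lemma place_graphN (R S : fieldType) (V : set (R * S)) x s :
  place_graph V -> V (x, s) -> V (- x, - s).
Proof.
move=> [V1 VB _ _]; have := VB _ _ _ _ V1 V1; rewrite !subrr => V0.
by move=> /(VB _ _ _ _ V0); rewrite !sub0r.
Qed.

Lemma place_graphD (R S : fieldType) (V : set (R * S)) x s y t :
  place_graph V -> V (x, s) -> V (y, t) -> V (x + y, s + t).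
Proof.
move=> fV xs /(place_graphN fV); have [_ VB _ _] := fV.
by move=> /(VB _ _ _ _ xs); rewrite !opprK.
Qed.

Lemma place_graph0 (R S : fieldType) (V : set (R * S)) :
  place_graph V -> V (0, 0).
Proof. by move=> [V1 VB _ _]; have := VB _ _ _ _ V1 V1; rewrite !subrr. Qed.

Lemma place_graph_nat (R S : fieldType) (V : set (R * S)) n :
  place_graph V -> V (n%:R, n%:R).
Proof.
move=> fV; elim: n => [|n IH]; first exact: place_graph0.
by rewrite -addn1 !natrD; apply: place_graphD => //; have [] := fV.
Qed.

(** For a graph closed under differences, uniqueness of the value at [0] is uniqueness
    everywhere. *)
Definition functional_graph (R S : fieldType) (G : set (R * S)) : Prop :=
  forall s, G (0, s) -> s = 0.

Section GraphMorphism.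
Variables (R S : fieldType) (G : set (R * S)).
Hypotheses (fG : field_graph G) (gG : functional_graph G).

(** The proofs are arguments of the predicate so that the subfield structure declared on it can
    refer to them. *)
Definition graph_dom of field_graph G & functional_graph G : {pred R} :=
  fun x => `[< exists s, G (x, s) >].
Local Notation D := (graph_dom fG gG).

Lemma graph_dom_divring : divring_closed D.
Proof.
have [G1 GB GM GV] := fG.
split=> [|x y|x y]; rewrite /in_mem /=.
- by apply/asboolP; exists 1.
- by move=> /asboolP[s xs] /asboolP[t yt]; apply/asboolP; exists (s - t); exact: GB.
- move=> /asboolP[s xs] /asboolP[t yt]; apply/asboolP; exists (s / t).
  by apply: GM => //; exact: GV.
Qed.

HB.instance Definition _ := GRing.isDivringClosed.Build R D graph_dom_divring.

Local Notation graph_field := (subfield D).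

Lemma graph_field_ex (x : graph_field) : exists s, G (val x, s).
Proof. by case: x => x /= /asboolP. Qed.

Definition graph_fun (x : graph_field) : S := projT1 (cid (graph_field_ex x)).

Lemma graph_funP x : G (val x, graph_fun x).
Proof. by rewrite /graph_fun; case: cid. Qed.

Lemma graph_uniq x s t : G (x, s) -> G (x, t) -> s = t.
Proof.
have [_ GB _ _] := fG; move=> Gs Gt; apply/eqP; rewrite -subr_eq0.
by apply/eqP/gG; rewrite -(subrr x); exact: GB.
Qed.

Lemma graph_fun_zmod_morphism : zmod_morphism graph_fun.
Proof.
have [_ GB _ _] := fG.
move=> x y; apply: (graph_uniq (graph_funP _)).
by apply: GB; exact: graph_funP.
Qed.

Lemma graph_fun_monoid_morphism : monoid_morphism graph_fun.
Proof.
have [G1 _ GM _] := fG; split=> [|x y]; first exact: (graph_uniq (graph_funP _)).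
by apply: (graph_uniq (graph_funP _)); apply: GM; exact: graph_funP.
Qed.

HB.instance Definition _ :=
  GRing.isZmodMorphism.Build graph_field S graph_fun graph_fun_zmod_morphism.
HB.instance Definition _ :=
  GRing.isMonoidMorphism.Build graph_field S graph_fun graph_fun_monoid_morphism.

Definition graph_elt x s (xs : G (x, s)) : graph_field :=
  exist _ x (introT (asboolP (exists s, G (x, s))) (ex_intro _ s xs)).

Lemma graph_eltE x s (xs : G (x, s)) : graph_fun (graph_elt xs) = s.
Proof. exact: (@graph_uniq x _ _ (graph_funP (graph_elt xs)) xs). Qed.

End GraphMorphism.


Definition algebraic_over_graph (R S : fieldType) (G : set (R * S)) (x : R) :=
  exists f : {poly R}, [/\ f != 0, root f x & forall i, exists s, G (f`_i, s)].

(** A Hensel property for simple roots. Equal sizes exclude a [g] of another degree, such as a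
    nonzero constant, whose coefficients [V] might still match with those of [f]. *)
Definition lifts_roots (R S : fieldType) (V : set (R * S)) : Prop :=
  forall (f : {poly R}) (g : {poly S}) (x : R),
    (forall i, V (f`_i, g`_i)) -> size f = size g ->
    root f x -> ~~ root f^`() x -> exists2 s, V (x, s) & root g s.

Lemma char0_deriv_neq0 (K : fieldType) (f : {poly K}) :
  (forall n, (n%:R == 0 :> K) = (n == 0)%N) -> (1 < size f)%N -> f^`() != 0.
Proof.
move=> ch0 sf; apply/eqP => /(congr1 (fun g : {poly K} => g`_(size f).-2)).
rewrite coef_deriv coef0; case E: (size f) sf => [|[|n]] //= _.
move/eqP; rewrite -mulr_natr mulf_eq0 ch0 orbF.
have -> : f`_n.+1 = lead_coef f by rewrite lead_coefE E.
by rewrite lead_coef_eq0 -size_poly_eq0 E.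
Qed.

(** The minimal polynomial [f] of [x] over the domain of [G] is separable in characteristic 0, so
    [x] is a simple root and lifts to a root [s] of the image of [f]. Sending [x] to [s] is well
    defined because every polynomial killing [x] is a multiple of [f]. *)
Lemma adjoin_algebraic (R S : fieldType) (V G : set (R * S)) (x : R) :
  (forall n, (n%:R == 0 :> R) = (n == 0)%N) ->
  place_graph V -> lifts_roots V ->
  field_graph G -> functional_graph G -> G `<=` V -> algebraic_over_graph G x ->
  exists G' : set (R * S), [/\ field_graph G', functional_graph G', G' `<=` V,
    G `<=` G' & exists s, G' (x, s)].
Proof.
move=> ch0 fV lV fG gG GV [f0 [f0n0 f0x f0G]].
(* From here on the domain of [G] is an abstract field [k], with its inclusion [io] in [R] and its
   map [si] to [S]. *)
have [k [io [si [GP kP]]]] : exists (k : fieldType) (io : {rmorphism k -> R})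
    (si : {rmorphism k -> S}), (forall y, G (io y, si y)) /\
    forall y s, G (y, s) -> exists z, io z = y /\ si z = s.
  exists (subfield (graph_dom fG gG)), \val, (@graph_fun _ _ _ fG gG); split.
    by move=> y; exact: graph_funP.
  move=> y s ys; exists (graph_elt fG gG ys); split=> //; exact: graph_eltE.
pose Q n := `[< exists f : {poly k}, [/\ f != 0, root (map_poly io f) x & size f = n] >].
have exQ : exists n, Q n.
  have /choice[c cP] : forall i, exists z : k, io z = f0`_i.
    by move=> i; have [s /kP[z [zi _]]] := f0G i; exists z.
  pose f := \poly_(i < size f0) c i.
  have fE : map_poly io f = f0.
    apply/polyP => i; rewrite coef_map coef_poly; case: ltnP => [_|le]; first exact: cP.
    by rewrite [LHS](rmorph0 io) nth_default.
  exists (size f); apply/asboolP; exists f; split; rewrite ?fE //.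
  by apply: contraNneq f0n0 => f_0; rewrite -fE f_0 rmorph0.
have [_ /asboolP[f [fn0 fx <-]] fmin] := ex_minnP exQ.
have dvd g : root (map_poly io g) x -> f %| g.
  move=> gx; rewrite /dvdp; apply: contraT => mn0.
  have : (size f <= size (g %% f)%R)%N.
    apply: fmin; apply/asboolP; exists (g %% f); split=> //.
    rewrite (_ : g %% f = g - g %/ f * f); last by rewrite {2}(divp_eq g f) addrAC subrr add0r.
    by rewrite rmorphB rmorphM /= /root hornerD hornerN hornerM (rootP gx) (rootP fx) mulr0 subrr.
  by rewrite leqNgt ltn_modp fn0.
have sf1 : (1 < size f)%N.
  rewrite ltnNge; apply/negP => /size1_polyC fC; move: fx fn0; rewrite fC.
  by rewrite map_polyC rootC fmorph_eq0 polyC_eq0 => ->.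
have chk n : (n%:R == 0 :> k) = (n == 0)%N.
  by rewrite -(fmorph_eq0 io) rmorph_nat ch0.
have nfx : ~~ root (map_poly io f)^`() x.
  rewrite deriv_map; apply/negP => /dvd /dvdp_leq.
  by rewrite (char0_deriv_neq0 chk sf1) leqNgt (lt_size_deriv fn0) => /(_ isT).
have [|||//|s Vxs fs] := lV (map_poly io f) (map_poly si f) x.
- by move=> i; rewrite !coef_map; apply: GV; exact: GP.
- by rewrite !size_map_poly.
- exact: fx.
have [V1 VB VM VV] := fV.
pose G' : set (R * S) := [set z | exists g : {poly k},
  z = ((map_poly io g).[x], (map_poly si g).[s])].
have G'C (c : k) : G' (io c, si c).
  by exists c%:P; rewrite !map_polyC !hornerC.
exists G'; split.
- split.
  + by have := G'C 1; rewrite !rmorph1.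
  + move=> _ _ _ _ [g [-> ->]] [h [-> ->]]; exists (g - h).
    by rewrite !rmorphB !hornerE.
  + move=> _ _ _ _ [g [-> ->]] [h [-> ->]]; exists (g * h).
    by rewrite !rmorphM !hornerE.
  + move=> _ _ [g [-> ->]].
    have [gx|gx] := boolP (root (map_poly io g) x).
      have /dvdpP[h ->] := dvd _ gx; rewrite !rmorphM /= !hornerM (rootP fx) (rootP fs).
      by rewrite !mulr0 !invr0; have := G'C 0; rewrite !rmorph0.
    (* The inverse is again a polynomial value: as [f] is irreducible and does not divide [g], some
       [w] satisfies [w * g = 1] modulo [f], and this can be evaluated both at [x] and at [s]. *)
    have cop : coprimep f g.
      rewrite irreducible_poly_coprime; last first.
        split=> // q q1 qf; rewrite /eqp qf /=.
        have /dvdpP[h fE] := qf.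
        have hn0 : h != 0 by apply: contraNneq fn0 => h0; rewrite fE h0 mul0r.
        have qn0 : q != 0 by apply: contraNneq fn0 => q0; rewrite fE q0 mulr0.
        move: fx; rewrite {1}fE rmorphM rootM => /orP[/dvd|/dvd//].
        move/dvdp_leq => /(_ hn0); rewrite {1}fE size_mul //.
        move: q1 qn0; rewrite -size_poly_eq0.
        by case: (size q) => [|[|n]] //; rewrite !addnS /= ltnNge leq_addr.
      by apply/negP => /dvdpP[h gE]; move: gx; rewrite gE rmorphM rootM fx orbT.
    have [[u w] /= uw] := Bezout_eq1_coprimepP _ _ cop.
    have inv (L : fieldType) (h : {rmorphism k -> L}) z : root (map_poly h f) z ->
        (map_poly h g).[z]^-1 = (map_poly h w).[z].
      move=> fz; apply: mulr1_eq; rewrite mulrC -hornerM -rmorphM.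
      have -> : w * g = 1 - u * f by rewrite -uw addrAC subrr add0r.
      by rewrite rmorphB rmorph1 rmorphM !hornerE (rootP fz) mulr0 subr0.
    by exists w; rewrite !inv.
- move=> t [g [/esym/eqP gx ->]]; have /dvdpP[h ->] := dvd _ gx.
  by rewrite rmorphM hornerM (rootP fs) mulr0.
- move=> _ [g ->]; elim/poly_ind: g => [|g c IH]; first by rewrite !rmorph0 !horner0; exact: place_graph0.
  rewrite !rmorphD !rmorphM /= !map_polyX !map_polyC !hornerE.
  apply: place_graphD => //; last exact: GV (GP c).
  exact: VM.
- by move=> [y t] /kP[z [<- <-]]; exact: G'C.
- by exists s, 'X; rewrite !map_polyX !hornerX.
Qed.

Lemma field_graph_bigcup (R S : fieldType) (C : set (set (R * S))) :
  C !=set0 -> total_on C subset -> (forall G, C G -> field_graph G) ->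
  field_graph (\bigcup_(G in C) G).
Proof.
move=> [G0 CG0] tot Cf; split.
- by exists G0 => //; have [] := Cf _ CG0.
- move=> x s y t [X CX xX] [Y CY yY]; have [Z [CZ xZ yZ]] := chain_two tot CX CY xX yY.
  by exists Z => //; have [_ h _ _] := Cf _ CZ; exact: h.
- move=> x s y t [X CX xX] [Y CY yY]; have [Z [CZ xZ yZ]] := chain_two tot CX CY xX yY.
  by exists Z => //; have [_ _ h _] := Cf _ CZ; exact: h.
- by move=> x s [X CX xX]; exists X => //; have [_ _ _ h] := Cf _ CX; exact: h.
Qed.

(** Each [x] is algebraic over [G], hence over a maximal graph inside [V], which must therefore
    already contain it. Zorn's lemma runs over the [H] whose union with [G] is admissible, so that
    the empty chain causes no exception. *)
Lemma extend_field_graph (R S : fieldType) (V G : set (R * S)) :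
  (forall n, (n%:R == 0 :> R) = (n == 0)%N) ->
  place_graph V -> lifts_roots V ->
  field_graph G -> functional_graph G -> G `<=` V ->
  (forall x, algebraic_over_graph G x) ->
  exists g : {rmorphism R -> S}, forall x s, G (x, s) -> g x = s.
Proof.
move=> ch0 fV lV fG gG GV alg.
pose P (H : set (R * S)) :=
  [/\ field_graph (H `|` G), functional_graph (H `|` G) & H `|` G `<=` V].
have [C CP tot|H [[fH gH HV] Hmax]] := @Zorn_bigcup _ P.
  have [->|/set0P[X0 CX0]] := eqVneq C set0.
    by rewrite /P bigcup_set0 set0U; split.
  rewrite /P (_ : _ `|` _ = \bigcup_(X in [set X `|` G | X in C]) X); last first.
    apply/seteqP; split=> z.
      by move=> [[X CX Xz]|Gz]; [exists (X `|` G)|exists (X0 `|` G)];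
        do ?[by exists X|by exists X0|by left|by right].
    by move=> [_ [X CX <-] [Xz|Gz]]; [left; exists X|right].
  split.
  - apply: field_graph_bigcup.
    + by exists (X0 `|` G); exists X0.
    + move=> _ _ [X CX <-] [Y CY <-].
      by have [XY|YX] := tot _ _ CX CY; [left|right]; exact: setSU.
    + by move=> _ [X CX <-]; have [] := CP _ CX.
  - by move=> s [_ [X CX <-]]; have [_ h _] := CP _ CX; exact: h.
  - by move=> z [_ [X CX <-]]; have [_ _ h] := CP _ CX; exact: h.
have tot x : exists s, (H `|` G) (x, s).
  have [|G' [fG' gG' GV' HG' [s G's]]] :=
    adjoin_algebraic ch0 fV lV fH gH HV (x := x).
    have [f [f0 fx fs]] := alg x; exists f; split=> // i.
    by have [s ?] := fs i; exists s; right.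
  have G'E : G' `|` G = G'.
    by apply/seteqP; split=> z; [move=> [//|Gz]; apply: HG'; right|left].
  exists s; apply: contrapT => nHs; apply: (Hmax G'); last by rewrite /P G'E.
  split=> [z Hz|sub]; first by apply: HG'; left.
  by apply: nHs; left; exact: sub.
have /choice[h hP] := tot; have [H1 HB HM _] := fH.
have hB : zmod_morphism h.
  by move=> x y; apply: (graph_uniq fH gH (hP _)); exact: HB.
have hM : monoid_morphism h.
  split=> [|x y]; first exact: (graph_uniq fH gH (hP _)).
  by apply: (graph_uniq fH gH (hP _)); exact: HM.
pose g : {rmorphism R -> S} := HB.pack h
  (GRing.isZmodMorphism.Build R S h hB) (GRing.isMonoidMorphism.Build R S h hM).
exists g => x s Gs; apply: (graph_uniq fH gH (hP x)); by right.
Qed.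

(** * Cardinality of the real numbers *)

Lemma injective_card_le (T U : Type) (A : set T) (B : set U) (f : T -> U) :
  (forall x, A x -> B (f x)) ->
  (forall x y, A x -> A y -> f x = f y -> x = y) -> A #<= B.
Proof.
move=> fAB fI; have [g] : $|{injfun A >-> B}|.
  apply/injfunPex; exists f => //.
  by move=> x y /set_mem Ax /set_mem Ay; exact: fI.
exact: inj_card_le.
Qed.

Lemma card_leT_inj (T U : Type) :
  [set: T] #<= [set: U] -> exists f : T -> U, injective f.
Proof.
move=> /card_leP[f]; exists (fun x => val (f (SigSub (mem_set (I : setT x))))) => x y.
by move=> /val_inj E; have [] := @inj _ _ _ f _ _ (mem_set I) (mem_set I) E.
Qed.

Section RealContinuum.
Variable R : realType.

Let term (A : set nat) n : R := if pselect (A n) then (1 / 3) ^+ n else 0.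
Let psum A N : R := \sum_(n < N) term A n.

Let pow_gt0 n : 0 < (1 / 3) ^+ n :> R.
Proof. by rewrite exprn_gt0 //; lra. Qed.

Let term_ge0 A n : 0 <= term A n.
Proof. by rewrite /term; case: pselect => //= _; exact: ltW. Qed.

Let term_le A n : term A n <= (1 / 3) ^+ n.
Proof. by rewrite /term; case: pselect => //= _; exact: ltW. Qed.

Let psumS A N : psum A N.+1 = psum A N + term A N.
Proof. by rewrite /psum big_ord_recr. Qed.

(** The factor [3 / 2] comes from summing the geometric series of ratio [1 / 3]; the difference is
    stated exactly so that the induction closes. *)
Let psum_tail A m k :
  psum A m <= psum A (m + k) <= psum A m + 3 / 2 * ((1 / 3) ^+ m - (1 / 3) ^+ (m + k)).
Proof.
elim: k => [|k /andP[IH1 IH2]]; first by rewrite addn0 lexx subrr mulr0 addr0 lexx.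
rewrite addnS psumS exprS; have := term_ge0 A (m + k); have := term_le A (m + k).
move: IH1 IH2; move: (psum A (m + k)) (term A (m + k)) ((1 / 3) ^+ (m + k)) => s t u.
move=> h1 h2 h3 h4.
by apply/andP; split; lra.
Qed.

Let psum_le A m k : psum A k <= psum A m + 3 / 2 * (1 / 3) ^+ m.
Proof.
have [/subnKC <-|/ltnW/subnKC km] := leqP m k.
  have /andP[_] := psum_tail A m (k - m); have := pow_gt0 (m + (k - m)).
  by move: ((1 / 3) ^+ (m + _)) => u; lra.
have /andP[+ _] := psum_tail A k (m - k); rewrite km; have := pow_gt0 m.
by move: ((1 / 3) ^+ m) => u; lra.
Qed.

Let lim A : R := sup (range (psum A)).

Let lim_ge A m : psum A m <= lim A.
Proof.
apply: ub_le_sup; last by exists m.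
by exists (psum A 0 + 3 / 2 * (1 / 3) ^+ 0) => _ [k _ <-].
Qed.

Let lim_le A m : lim A <= psum A m + 3 / 2 * (1 / 3) ^+ m.
Proof. by apply: ge_sup => [|_ [k _ <-]//]; exists (psum A 0), 0%N. Qed.

(** Base 3 keeps the sums apart: at the first difference [m], the set [A] gains [(1 / 3) ^+ m],
    while all later terms of [B] together give at most half of that. *)
Let lim_lt A B m : (forall k, (k < m)%N -> A k <-> B k) -> A m -> ~ B m ->
  lim B < lim A.
Proof.
move=> AB Am Bm; have E : psum A m = psum B m.
  apply: eq_bigr => k _; rewrite /term.
  by case: pselect; case: pselect => //= h1 h2; case: h1 || case: h2; apply/AB.
have := lim_ge A m.+1; have := lim_le B m.+1; have := pow_gt0 m.
rewrite !psumS E exprS /term.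
case: pselect => //= _; case: pselect => //= _.
by move: ((1 / 3) ^+ m) (psum B m) (lim A) (lim B) => u s a b; lra.
Qed.

Lemma real_of_set_inj : exists f : set nat -> R, injective f.
Proof.
exists lim => A B E; apply/funext => n; apply/propext.
elim/ltn_ind: n => m IH; split=> h; apply: contrapT => nh.
  by have := lim_lt IH h nh; rewrite E ltxx.
have IH' k : (k < m)%N -> B k <-> A k by move=> /IH; tauto.
by have := lim_lt IH' h nh; rewrite E ltxx.
Qed.

Lemma set_of_real_inj : exists f : R -> set nat, injective f.
Proof.
pose f (x : R) : set nat := [set n | exists2 q : rat, ratr q < x & n = pickle q].
have mono x y : f x = f y -> x <= y.
  move=> E; rewrite leNgt; apply/negP => /rat_in_itvoo[q].
  rewrite in_itv => /andP[yq qx].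
  have : f x (pickle q) by exists q.
  rewrite E => -[q' q'y /(pcan_inj pickleK) qq'].
  by have := lt_trans q'y yq; rewrite qq' ltxx.
by exists f => x y E; apply/eqP; rewrite eq_le !mono.
Qed.

End RealContinuum.

(** * Embeddings with prescribed values on a transcendence basis *)

Lemma place_graph_peval (R S : fieldType) (J : Type) (b : J -> R) (h : J -> S)
    (V : set (R * S)) p :
  place_graph V -> (forall j, V (b j, h j)) -> V (peval b p, peval h p).
Proof.
move=> fV Vbh; have [_ _ VM _] := fV.
elim: p => [j|n|q ?|q ? r ?|q ? r ?] //=.
- exact: place_graph_nat.
- exact: place_graphN.
- exact: place_graphD.
- exact: VM.
Qed.

Section FamilyGraph.
Variables (R S : fieldType) (J : Type) (b : J -> R) (h : J -> S).
Hypothesis bh : forall p, peval b p = 0 <-> peval h p = 0.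

(** When both families satisfy the same polynomial relations, this is the isomorphism between the
    fields they generate. *)
Definition family_graph : set (R * S) := [set z | exists p q : pexp J,
  peval b q != 0 /\ z = (peval b p / peval b q, peval h p / peval h q)].

Let hn0 q : peval b q != 0 -> peval h q != 0.
Proof. by apply: contraNneq => /bh ->. Qed.

Lemma family_graph_field : field_graph family_graph.
Proof.
split.
- by exists (PNat 1), (PNat 1); rewrite /= !divr1 oner_neq0.
- move=> _ _ _ _ [p [q [q0 [-> ->]]]] [p' [q' [q'0 [-> ->]]]].
  exists (PAdd (PMul p q') (POpp (PMul p' q))), (PMul q q') => /=.
  by rewrite mulf_neq0 // -!mulNr !addf_div ?hn0 // !mulNr.
- move=> _ _ _ _ [p [q [q0 [-> ->]]]] [p' [q' [q'0 [-> ->]]]].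
  exists (PMul p p'), (PMul q q') => /=.
  by rewrite mulf_neq0 // !mulf_div.
- move=> _ _ [p [q [q0 [-> ->]]]]; have [p0|p0] := eqVneq (peval b p) 0.
    exists (PNat 0), q; split=> //; have /bh p0' := p0.
    by rewrite p0 p0' /= !mul0r !invr0.
  by exists q, p; rewrite !invf_div.
Qed.

Lemma family_graph_functional : functional_graph family_graph.
Proof.
move=> s [p [q [q0 [/esym/eqP]]]].
rewrite mulf_eq0 invr_eq0 (negPf q0) orbF => /eqP/bh -> ->.
by rewrite mul0r.
Qed.

Lemma family_graph_elt j : family_graph (b j, h j).
Proof. by exists (PVar j), (PNat 1); rewrite /= !divr1 oner_neq0. Qed.

Lemma family_graph_sub (V : set (R * S)) :
  place_graph V -> (forall j, V (b j, h j)) -> family_graph `<=` V.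
Proof.
move=> fV Vbh; have [_ _ VM VV] := fV.
have Ve p := place_graph_peval p fV Vbh.
by move=> _ [p [q [q0 ->]]]; apply: VM => //; exact: VV.
Qed.

End FamilyGraph.

(** Independent families satisfy the same relations, namely the null ones, so they generate
    isomorphic fields. The isomorphism lies inside [V] and extends to all of [R], which is algebraic
    over the first field. *)
Lemma extend_family (R S : fieldType) (V : set (R * S)) (J : Type)
    (b : J -> R) (h : J -> S) :
  (forall n, (n%:R == 0 :> R) = (n == 0)%N) ->
  (forall n, (n%:R == 0 :> S) = (n == 0)%N) ->
  place_graph V -> lifts_roots V ->
  independent b -> independent h -> (forall y, algebraic_over_family b y) ->
  (forall j, V (b j, h j)) ->
  exists g : {rmorphism R -> S}, forall j, g (b j) = h j.
Proof.
move=> chR chS fV lV ib ih alg Vbh.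
have bh p : peval b p = 0 <-> peval h p = 0.
  by split=> [/ib|/ih] ?; exact: pnull_eval.
have [|g gP] := extend_field_graph chR fV lV (family_graph_field bh)
    (family_graph_functional bh) (family_graph_sub fV Vbh).
  move=> y; have [qs [qs0 qsy]] := alg y; eexists; split; [exact: qs0|exact: qsy|].
  move=> i; rewrite coef_Poly; have [lt|ge] := ltnP i (size qs).
    rewrite (nth_map (PNat 0)) //; set q := nth _ _ _.
    by exists (peval h q), q, (PNat 1); rewrite /= !divr1 oner_neq0.
  rewrite nth_default ?size_map //; exists 0, (PNat 0), (PNat 1).
  by rewrite /= !mul0r oner_neq0.
by exists g => j; apply: gP; exact: family_graph_elt.
Qed.

(** A set [X] of sets of numbers selects the value [h1] exactly on its image under [i]; the
    embedding evaluated at [b (i A)] then tells whether [A] belongs to [X]. *)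
Lemma power_continuum_embeddings (R S : fieldType) (J : Type)
    (i : set nat -> J) (b : J -> R) (h0 h1 : J -> S) :
  injective i -> (forall j, h0 j <> h1 j) ->
  (forall e : J -> bool, exists g : {rmorphism R -> S},
     forall j, g (b j) = if e j then h1 j else h0 j) ->
  power_continuum #<= @field_embeddings R S.
Proof.
move=> iI h01 ex.
have /choice[g gP] : forall X : set (set nat), exists g : {rmorphism R -> S},
    forall j, g (b j) = if `[< exists2 A, X A & i A = j >] then h1 j else h0 j.
  by move=> X; exact: ex.
apply: (injective_card_le (f := fun X => g X : R -> S)) => [X _|X Y _ _ E].
  by exists (g X).
have iX X' A : `[< exists2 B, X' B & i B = i A >] = `[< X' A >].
  by apply/asboolP/asboolP => [[B XB /iI <-]//|XA]; exists A.
apply/funext => A; apply/propext; have := congr1 (fun f : R -> S => f (b (i A))) E.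
rewrite /= !gP !iX; case: asboolP; case: asboolP => // _ _ e; exfalso.
  by case: (h01 (i A)).
exact: (h01 (i A)).
Qed.

Lemma closed_field_root (S : fieldType) (g : {poly S}) :
  GRing.closed_field_axiom S -> (1 < size g)%N -> exists s, root g s.
Proof.
move=> cS sg; pose n := (size g).-1.
have sgE : size g = n.+1 by rewrite /n prednK // ltnW.
have l0 : lead_coef g != 0 by rewrite lead_coef_eq0 -size_poly_eq0 sgE.
have [|s sE] := cS n (fun i => - (g`_i / lead_coef g)); first by rewrite -ltnS -sgE.
exists s; rewrite /root horner_coef sgE big_ord_recr /= sE -/n.
have -> : g`_n = lead_coef g by rewrite lead_coefE.
rewrite mulr_sumr -big_split /= big1 // => k _.
by rewrite mulNr mulrN mulrA mulrCA divff // mulr1 subrr.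
Qed.

(** With the full relation as [V], lifting a root only asks that [g] have one. Every basis element
    receives two targets in an independent family of [S], all targets being distinct, so each choice
    of targets is an injection. *)
Lemma closed_field_embeddings (R : realType) (S : fieldType) :
  (forall n, (n%:R == 0 :> S) = (n == 0)%N) ->
  GRing.closed_field_axiom S -> continuum #<= [set: S] ->
  power_continuum #<= @field_embeddings R S.
Proof.
move=> chS cS /card_leT_inj[c cI].
have [cR cRI] := real_of_set_inj R; have [d dI] := set_of_real_inj R.
have [J [b [i [iI bI ib alg]]]] := big_independent_family (@pnatr_eq0 R) cRI.
have [JS [x [iS [iSI xI ix _]]]] := big_independent_family chS cI.
(* The set is stored on the even numbers and the bit at position 1, so that both can be
   recovered. *)
pose D (e : bool) (A : set nat) : set nat :=
  [set n | (exists2 m, A m & n = m.*2) \/ (e /\ n = 1%N)].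
have DI e e' A A' : D e A = D e' A' -> e = e' /\ A = A'.
  move=> E; have E' n : D e A n <-> D e' A' n by rewrite E.
  have one e0 A0 : D e0 A0 1%N <-> e0.
    by split=> [[[[|m] _]//|[]]|?] //; right.
  have dbl e0 A0 m : D e0 A0 m.*2 <-> A0 m.
    split=> [[[k Ak /double_inj ->]//|[_ /(congr1 odd)]]|?].
      by rewrite odd_double.
    by left; exists m.
  split; last by apply/funext => m; apply/propext; rewrite -(dbl e A) -(dbl e' A').
  apply/idP/idP => h.
    by apply/(one _ A'); rewrite -E; apply/one.
  by apply/(one _ A); rewrite E; apply/one.
pose t (e : bool) (j : J) := x (iS (D e (d (b j)))).
apply: (power_continuum_embeddings (i := i) (b := b) (h0 := t false) (h1 := t true)) => //.
  by move=> j /xI/iSI/DI[].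
move=> e; pose k (j : J) := iS (D (e j) (d (b j))).
have kI : injective k by move=> j j' /iSI/DI[_ /dI/bI].
have [||||||g gP] := extend_family (V := setT) (b := b) (h := x \o k) (@pnatr_eq0 R) chS.
- by [].
- move=> f g y _ sfg fy nfy; have [|s gs] := @closed_field_root _ g cS.
    rewrite -sfg; have f0 : f != 0.
      by apply: contraNneq nfy => ->; rewrite deriv0 root0.
    by have := root_size_gt1 f0 fy.
  by exists s.
- exact: ib.
- exact: independent_comp.
- exact: alg.
- by [].
by exists g => j; rewrite gP /t /k /=; case: (e j).
Qed.

(** * Standard parts *)

Lemma near_sub (K : realFieldType) (a b q r e : K) :
  `|a - q| < e / 2 -> `|b - r| < e / 2 -> `|(a - b) - (q - r)| < e.
Proof.
rewrite !ltr_norml => /andP[? ?] /andP[? ?]; apply/andP; split; lra.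
Qed.

Lemma near_mul (K : realFieldType) (a b q r M N d e : K) :
  0 < M -> 0 < N -> d <= 1 -> d * (M + N + 1) <= e ->
  `|a| <= M -> `|b| <= N -> `|a - q| < d -> `|b - r| < d ->
  `|a * b - q * r| < e.
Proof.
move=> M0 N0 d1 de aM bN aq br.
have -> : a * b - q * r = a * (b - r) + (a - q) * b - (a - q) * (b - r) by ring.
have d0 : 0 < d by apply: le_lt_trans aq.
apply: lt_le_trans de; apply: le_lt_trans (ler_normB _ _) _.
have h1 : `|a * (b - r)| <= M * d by rewrite normrM ler_pM // ltW.
have h2 : `|(a - q) * b| <= d * N by rewrite normrM ler_pM // ltW.
have h3 : `|(a - q) * (b - r)| < d * 1.
  rewrite normrM; apply: lt_le_trans (ltr_pM _ _ aq br) _ => //.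
  by rewrite ler_pM2l.
have := ler_normD (a * (b - r)) ((a - q) * b); lra.
Qed.

Lemma near_inv (K : realFieldType) (a q d e c : K) :
  0 < c -> c <= `|a| -> c <= `|q| -> d <= e * c * c -> `|a - q| < d ->
  `|a^-1 - q^-1| < e.
Proof.
move=> c0 ca cq de aq.
have a0 : a != 0 by rewrite -normr_gt0; exact: lt_le_trans ca.
have q0 : q != 0 by rewrite -normr_gt0; exact: lt_le_trans cq.
have -> : a^-1 - q^-1 = (q - a) / (a * q) by field; rewrite a0 q0.
rewrite normrM normfV normrM ltr_pdivrMr ?mulr_gt0 ?normr_gt0 // distrC.
have e0 : 0 < e.
  have d0 : 0 < d by exact: le_lt_trans (normr_ge0 _) aq.
  by have := lt_le_trans d0 de; rewrite -mulrA pmulr_lgt0 // mulr_gt0.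
apply: (lt_le_trans aq); apply: (le_trans de); rewrite -mulrA.
by rewrite ler_pM2l //; apply: ler_pM => //; exact: ltW.
Qed.

Section StandardPart.
Variables (R : realType) (L : rcfType).

(* [(x, s)] is in this graph when [x] is the standard part of [s]. *)
Definition standard_part : set (R * L) := [set z | forall e : rat, 0 < e ->
  exists q : rat, `|z.1 - ratr q| < ratr e /\ `|z.2 - ratr q| < ratr e].

Local Notation V := standard_part.

Lemma small_rat (x : R) : 0 < x -> exists2 e : rat, 0 < e & ratr e < x.
Proof.
move=> /rat_in_itvoo[e]; rewrite in_itv => /andP[e0 ex]; exists e => //.
by rewrite -(ltr0q R).
Qed.

Lemma standard_part_rat q : V (ratr q, ratr q).
Proof. by move=> e e0; exists q; rewrite !subrr !normr0 !ltr0q. Qed.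

Lemma standard_partB x s y t : V (x, s) -> V (y, t) -> V (x - y, s - t).
Proof.
move=> xs yt e e0; have e20 : 0 < e / 2 by lra.
have [q [/= xq sq]] := xs _ e20; have [r [/= yr tr]] := yt _ e20.
have half (K : realFieldType) : ratr (e / 2) = ratr e / 2 :> K.
  by rewrite fmorph_div rmorph_nat.
exists (q - r); rewrite !rmorphB /=; split; apply: near_sub; by rewrite -half.
Qed.

Lemma standard_part_bounded x s : V (x, s) ->
  exists M : rat, [/\ 0 < M, `|x| <= ratr M & `|s| <= ratr M].
Proof.
have bd (K : realFieldType) (a q : K) : `|a - q| < 1 -> `|a| <= `|q| + 1.
  by move=> aq; have := ler_normD (a - q) q; rewrite subrK; lra.
move=> /(_ 1 ltr01)[q /=]; rewrite !rmorph1 => -[xq sq]; exists (`|q| + 1); split.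
- by rewrite ltr_wpDl.
- by rewrite rmorphD /= ratr_norm rmorph1; exact: bd.
- by rewrite rmorphD /= ratr_norm rmorph1; exact: bd.
Qed.

Lemma standard_partM x s y t : V (x, s) -> V (y, t) -> V (x * y, s * t).
Proof.
move=> xs yt e e0; have [M [M0 xM sM]] := standard_part_bounded xs.
have [N [N0 yN tN]] := standard_part_bounded yt.
have c0 : 0 < M + N + 1 by lra.
pose d := Num.min 1 (e / (M + N + 1)).
have d0 : 0 < d by rewrite lt_min ltr01 divr_gt0.
have [q [/= xq sq]] := xs _ d0; have [r [/= yr tr]] := yt _ d0.
have d1 (K : realFieldType) : ratr d <= 1 :> K.
  by rewrite -(rmorph1 (@ratr K)) ler_rat ge_min lexx.
have de (K : realFieldType) : ratr d * (ratr M + ratr N + 1) <= ratr e :> K.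
  rewrite -(rmorph1 (@ratr K)) -!rmorphD -rmorphM ler_rat -ler_pdivlMr //.
  by rewrite ge_min lexx orbT.
exists (q * r); rewrite !rmorphM /=; split.
- by apply: (near_mul (M := ratr M) (N := ratr N) (d := ratr d)); rewrite ?ltr0q.
- by apply: (near_mul (M := ratr M) (N := ratr N) (d := ratr d)); rewrite ?ltr0q.
Qed.

Lemma standard_part_away x s : V (x, s) -> 0 < x ->
  exists2 c : rat, 0 < c & ratr c < s.
Proof.
(* With [c < x] and error [c / 3], the common approximation exceeds [2 c / 3], and [s] exceeds
   [c / 3]. *)
move=> xs /small_rat[c c0 cx]; exists (c / 3); first by lra.
have c30 : 0 < c / 3 by lra.
have [q [/=]] := xs _ c30; have e3 (K : realFieldType) : ratr (c / 3) = ratr c / 3 :> K.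
  by rewrite fmorph_div rmorph_nat.
rewrite !e3 !ltr_norml => /andP[_ xq] /andP[sq _].
have : ratr (c * (2 / 3)) < ratr q :> R.
  by rewrite rmorphM fmorph_div /= !rmorph_nat; lra.
rewrite ltr_rat -(ltr_rat L) rmorphM fmorph_div /= !rmorph_nat; lra.
Qed.

Lemma standard_partV x s : x != 0 -> V (x, s) -> V (x^-1, s^-1).
Proof.
suff pos y t : 0 < y -> V (y, t) -> V (y^-1, t^-1).
  move=> x0 xs; have [x_lt0|/pos/(_ xs)//|x_0] := ltgtP x 0; last first.
    by rewrite x_0 eqxx in x0.
  have Nxs : V (- x, - s).
    rewrite -[- x]sub0r -[- s]sub0r; apply: standard_partB => //.
    by have := standard_part_rat 0; rewrite !rmorph0.
  have := pos (- x) (- s); rewrite oppr_gt0 => /(_ x_lt0 Nxs).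
  rewrite !invrN => h; rewrite -[x^-1]opprK -[s^-1]opprK -[- - x^-1]sub0r -[- - s^-1]sub0r.
  by apply: standard_partB => //; have := standard_part_rat 0; rewrite !rmorph0.
move=> y0 yt e e0.
have [c1 c10 c1t] := standard_part_away yt y0; have [c2 c20 c2y] := small_rat y0.
(* Half of the common lower bound: an approximation within [c] of either value then still exceeds
   [c]. *)
pose c := Num.min c1 c2 / 2.
have c0 : 0 < c by rewrite divr_gt0 // lt_min c10.
have cc1 : c + c <= c1 by rewrite -splitr ge_min lexx.
have cc2 : c + c <= c2 by rewrite -splitr ge_min lexx orbT.
pose d := Num.min c (e * c * c).
have d0 : 0 < d by rewrite lt_min c0 /= mulr_gt0 // mulr_gt0.
have [q [/= yq tq]] := yt _ d0; exists q^-1; rewrite !fmorphV.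
have inv (K : realFieldType) (a : K) : ratr (c + c) < a -> `|a - ratr q| < ratr d ->
    `|a^-1 - (ratr q)^-1| < ratr e.
  move=> ca aq; have rc0 : 0 < ratr c :> K by rewrite ltr0q.
  have dc : ratr d <= ratr c :> K by rewrite ler_rat ge_min lexx.
  move: ca; rewrite rmorphD /= => ca.
  apply: (near_inv (c := ratr c) _ _ _ _ aq) => //.
  - by apply: le_trans (ler_norm _); lra.
  - apply: le_trans (ler_norm _); move: aq; rewrite ltr_norml => /andP[_ ?]; lra.
  - by rewrite -!rmorphM ler_rat ge_min lexx orbT.
by split; apply: inv => //; [apply: le_lt_trans c2y|apply: le_lt_trans c1t]; rewrite ler_rat.
Qed.

Lemma standard_part_place : place_graph V.
Proof.
split; [|exact: standard_partB|exact: standard_partM|exact: standard_partV].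
by have := standard_part_rat 1; rewrite !rmorph1.
Qed.

Lemma standard_part_gt0 x s : V (x, s) -> 0 < x -> 0 < s.
Proof.
move=> xs /(standard_part_away xs)[c c0]; apply: lt_trans; by rewrite ltr0q.
Qed.

Lemma standard_part_le x s y t : V (x, s) -> V (y, t) -> s <= t -> x <= y.
Proof.
move=> xs yt st; rewrite leNgt; apply/negP => yx.
have := standard_part_gt0 (standard_partB xs yt); rewrite subr_gt0 => /(_ yx).
by rewrite subr_gt0 ltNge st.
Qed.

(** The standard part of a finite element is the supremum of the rationals below it. *)
Lemma standard_part_ex (a b : rat) t : ratr a <= t -> t <= ratr b ->
  exists y, V (y, t).
Proof.
move=> at_ tb; pose E : set R := [set x | exists2 q : rat, x = ratr q & ratr q <= t].
have supE : has_sup E.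
  split; first by exists (ratr a), a.
  by exists (ratr b) => _ [q -> qt]; rewrite ler_rat -(ler_rat L); exact: le_trans tb.
exists (sup E) => e e0.
have [|_ [q -> qt] qe] := sup_adherent (_ : 0 < ratr e) supE; first by rewrite ltr0q.
have qs : ratr q <= sup E by apply: sup_upper_bound => //; exists q.
exists q; split; rewrite /= ger0_norm ?subr_ge0 //; first by lra.
rewrite ltrBlDr -rmorphD ltNge; apply/negP => h.
have : ratr (e + q) <= sup E by apply: sup_upper_bound => //; exists (e + q).
by rewrite rmorphD /=; lra.
Qed.

Lemma standard_part_horner (f : {poly R}) (g : {poly L}) y t :
  (forall i, V (f`_i, g`_i)) -> size f = size g -> V (y, t) -> V (f.[y], g.[t]).
Proof.
move=> fg sfg yt; rewrite !horner_coef sfg.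
have V0 : V (0, 0) by have := standard_part_rat 0; rewrite !rmorph0.
apply: (big_ind2 (fun x s => V (x, s))) => // [x s x' s' ? ?|i _].
  exact: (place_graphD standard_part_place).
apply: standard_partM => //; elim: (nat_of_ord i) => [|n IH].
  by rewrite !expr0; have := standard_part_rat 1; rewrite !rmorph1.
by rewrite !exprS; exact: standard_partM.
Qed.

(** Around a simple root [x] the cofactor [h] keeps its sign, so [f] changes sign between rationals
    [a < x < b]. Rationals are their own standard parts, hence [g] has the same strict signs there
    and a root between [a] and [b]. The standard part of that root is a root of [f] in the region
    where [h] does not vanish, so it is [x]. *)
Lemma standard_part_lifts_roots : lifts_roots V.
Proof.
move=> f g x fg sfg fx nfx.
have [h fE] := factor_theorem _ _ fx.
have hx : h.[x] != 0.
  move: nfx; rewrite fE derivM derivXsubC mulr1 rootE hornerD hornerM.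
  by rewrite hornerXsubC subrr mulr0 add0r.
wlog hx0 : f g h {fx nfx} fg sfg fE hx / 0 < h.[x].
  move=> W; have [hlt|hgt|h0] := ltgtP h.[x] 0; last by rewrite h0 eqxx in hx.
    have [|||||s xs gs] := W (- f) (- g) (- h).
    - by move=> i; rewrite !coefN; exact: (place_graphN standard_part_place).
    - by rewrite !size_polyN.
    - by rewrite fE mulNr.
    - by rewrite hornerN oppr_eq0.
    - by rewrite hornerN oppr_gt0.
    by exists s => //; move: gs; rewrite rootN.
  exact: (W f g h).
have [d d0 hd] := poly_cont x h hx0.
have hpos y : `|y - x| < d -> 0 < h.[y].
  by move=> /hd; rewrite ltr_norml => /andP[? _]; lra.
have [a] : exists a : rat, ratr a \in `]x - d, x[ by apply: rat_in_itvoo; lra.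
have [b] : exists b : rat, ratr b \in `]x, x + d[ by apply: rat_in_itvoo; lra.
rewrite !in_itv /= => /andP[xb bx] /andP[ax xa].
have ha : 0 < h.[ratr a] by apply: hpos; rewrite ltr_norml; apply/andP; split; lra.
have hb : 0 < h.[ratr b] by apply: hpos; rewrite ltr_norml; apply/andP; split; lra.
have fa : 0 < - f.[ratr a].
  by rewrite fE hornerM hornerXsubC -mulrN mulr_gt0 // oppr_gt0 subr_lt0.
have fb : 0 < f.[ratr b] by rewrite fE hornerM hornerXsubC mulr_gt0 // subr_gt0.
have Vab q : V (f.[ratr q], g.[ratr q]).
  by apply: standard_part_horner => //; exact: standard_part_rat.
have ga := standard_part_gt0 (place_graphN standard_part_place (Vab a)) fa.
have gb := standard_part_gt0 (Vab b) fb.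
have ab : ratr a <= ratr b :> L.
  by rewrite ler_rat -(ler_rat R) ltW // (lt_trans xa).
have [|s /andP[as_ sb] gs] := poly_ivt (p := g) ab.
  by rewrite (ltW gb) andbT -oppr_ge0 ltW.
have [y ys] := standard_part_ex as_ sb.
have ay : ratr a <= y := standard_part_le (standard_part_rat a) ys as_.
have yb : y <= ratr b := standard_part_le ys (standard_part_rat b) sb.
have hy : 0 < h.[y] by apply: hpos; rewrite ltr_norml; apply/andP; split; lra.
have fy : f.[y] = 0.
  have Vf := standard_part_horner fg sfg ys; rewrite (rootP gs) in Vf.
  have V0 : V (0, 0) by have := standard_part_rat 0; rewrite !rmorph0.
  by apply/eqP; rewrite eq_le (standard_part_le Vf V0) // (standard_part_le V0 Vf).
move: fy; rewrite fE hornerM hornerXsubC => /eqP; rewrite mulf_eq0 gt_eqF //=.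
by rewrite subr_eq0 => /eqP yx; exists s => //; rewrite -yx.
Qed.

End StandardPart.

(** Any family of lifts of [b] is independent: taking standard parts turns a relation among the
    lifts into the same relation among the elements of [b]. *)
Lemma rcf_embeddings (R : realType) (L : rcfType) (eps : L) :
  (forall x : R, exists s : L, @standard_part R L (x, s)) ->
  eps != 0 -> @standard_part R L (0, eps) ->
  power_continuum #<= @field_embeddings R L.
Proof.
move=> /choice[st stP] e0 Ve; have [cR cRI] := real_of_set_inj R.
have [J [b [i [iI bI ib alg]]]] := big_independent_family (@pnatr_eq0 R) cRI.
have pV := @standard_part_place R L.
apply: (power_continuum_embeddings (i := i) (b := b) (h0 := st \o b)
  (h1 := fun j => st (b j) + eps)) => //.
  move=> j /= /eqP; rewrite -[X in X == _]addr0 (inj_eq (addrI _)) eq_sym => /eqP E.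
  by rewrite E eqxx in e0.
move=> e; pose h j := if e j then st (b j) + eps else st (b j).
have Vbh j : @standard_part R L (b j, h j).
  rewrite /h; case: (e j) => //.
  by have := place_graphD pV (stP (b j)) Ve; rewrite addr0.
have ih : independent h.
  move=> p hp0; apply: ib; have := place_graph_peval p pV Vbh; rewrite hp0 => V0.
  have V00 := place_graph0 pV.
  by apply/eqP; rewrite eq_le (standard_part_le V0 V00) // (standard_part_le V00 V0).
have [g gP] := extend_family (@pnatr_eq0 R) (@pnatr_eq0 L) pV
  (@standard_part_lifts_roots R L) ib ih alg Vbh.
by exists g => j; rewrite gP.
Qed.

(** * Saturated real closed fields *)

Lemma saturated_limit (K : fieldType) (Phi : set (GRing.formula K)) (u : nat -> K) :
  aleph1_saturated K ->
  (forall f, Phi f -> ring_formula_over set0 [set 0%N] f) ->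
  (forall f, Phi f -> exists N, forall n, (N <= n)%N -> GRing.holds [:: u n] f) ->
  exists x, forall f, Phi f -> GRing.holds [:: x] f.
Proof.
move=> sat over ev; apply: (sat set0) => //.
move=> Psi finPsi PsiPhi.
have [|N NP] := @choice_in _ _ Psi
    (fun f m => forall n, (m <= n)%N -> GRing.holds [:: u n] f) 0%N.
  by move=> f /PsiPhi/ev.
have /finite_seqP[s sE] : finite_set (N @` Psi) by exact: finite_image.
(* A term of [u] beyond the thresholds of the finitely many formulas satisfies them all. *)
exists (u (\max_(i <- s) i)) => f Psif; apply: (NP _ Psif).
have sf : N f \in s by have : (N @` Psi) (N f) by [exists f]; rewrite sE.
exact: (leq_bigmax_seq (F := id) _ sf).
Qed.

Section RealClosedSaturated.
Variables (R : realType) (K : fieldType) (L : rcfType) (f : {rmorphism K -> L}).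
Hypotheses (fbij : bijective f) (sat : aleph1_saturated K).

Let finv (y : L) : K := projT1 (cid (let: Bijective g _ gK := fbij in
  ex_intro (fun x => f x = y) (g y) (gK y))).

Let finvK y : f (finv y) = y.
Proof. by rewrite /finv; case: cid. Qed.

(** Comparison with the rational [(m - m') / d], written in the language of rings: nonnegative
    elements are squares, and numerals on both sides avoid parameters. *)
Let lower (m m' d : nat) : GRing.formula K :=
  ('exists 'X_1, 'X_0 *+ d + (m'%:R)%T == m%:R + 'X_1 * 'X_1)%T.
Let upper (m m' d : nat) : GRing.formula K :=
  ('exists 'X_1, 'X_0 *+ d + (m'%:R)%T + 'X_1 * 'X_1 == m%:R)%T.

Let lowerP x m m' d : GRing.holds [:: x] (lower m m' d) <->
  m%:R - m'%:R <= f x *+ d.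
Proof.
split=> /= [[y E]|h].
  have := congr1 f E; rewrite !rmorphD rmorphM rmorphMn !rmorph_nat => E'.
  by have := sqr_ge0 (f y); rewrite expr2; lra.
have : 0 <= f x *+ d - (m%:R - m'%:R) by rewrite subr_ge0.
move=> /sqr_sqrtr E; exists (finv (Num.sqrt (f x *+ d - (m%:R - m'%:R)))).
apply: (bij_inj fbij); rewrite !rmorphD rmorphM rmorphMn !rmorph_nat /= finvK -expr2 E; ring.
Qed.

Let upperP x m m' d : GRing.holds [:: x] (upper m m' d) <->
  f x *+ d <= m%:R - m'%:R.
Proof.
split=> /= [[y E]|h].
  have := congr1 f E; rewrite !rmorphD rmorphM rmorphMn !rmorph_nat => E'.
  by have := sqr_ge0 (f y); rewrite expr2; lra.
have : 0 <= (m%:R - m'%:R) - f x *+ d by rewrite subr_ge0.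
move=> /sqr_sqrtr E; exists (finv (Num.sqrt ((m%:R - m'%:R) - f x *+ d))).
apply: (bij_inj fbij); rewrite !rmorphD rmorphM rmorphMn !rmorph_nat /= finvK -expr2 E; ring.
Qed.

Let rat_form (q : rat) : exists (m m' d : nat), (0 < d)%N /\
  forall F : numFieldType, ratr q *+ d = m%:R - m'%:R :> F.
Proof.
have [d dE] : exists d : nat, denq q = d%:Z by exists `|denq q|%N; rewrite gtz0_abs.
have d0 : (0 < d)%N by rewrite -ltz_nat -dE.
have [m [m' mE]] : exists m m' : nat, numq q = m%:Z - m'%:Z.
  by case: (numq q) => n; [exists n, 0%N|exists 0%N, n.+1]; rewrite ?subr0 ?sub0r ?NegzE.
exists m, m', d; split=> // F.
rewrite /ratr mE dE rmorphB /= -!pmulrn -[LHS]mulr_natr.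
by rewrite divfK // pnatr_eq0 -lt0n.
Qed.

(** A lift of [r] realizes the type of all strict rational bounds of [r], taken as weak
    inequalities. Rationals decreasing to [r] satisfy each of them from some point on. *)
Let near_ratr (r : R) : exists s : L, standard_part (r, s).
Proof.
have /choice[u uP] : forall n, exists q : rat, r < ratr q < r + n.+1%:R^-1.
  move=> n; have /rat_in_itvoo[q] : r < r + n.+1%:R^-1 by rewrite ltrDl invr_gt0 ltr0n.
  by rewrite in_itv; exists q.
pose Phi : set (GRing.formula K) := [set g | exists q : rat, exists m m' d : nat,
  [/\ (0 < d)%N, forall F : numFieldType, ratr q *+ d = m%:R - m'%:R :> F &
    (ratr q < r /\ g = lower m m' d) \/ (r < ratr q /\ g = upper m m' d)]].
have [||x xP] :=
    saturated_limit (Phi := Phi) (u := fun n => finv (ratr (u n))) sat.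
- by move=> _ [q [m [m' [d [_ _ [[_ ->]|[_ ->]]]]]]] /=; do !split; auto.
- move=> _ [q [m [m' [d [d0 qE [[qr ->]|[rq ->]]]]]]].
    exists 0%N => n _; apply/lowerP; rewrite finvK -qE.
    rewrite lerMn2r (ler_rat L) -(ler_rat R); apply/orP; right; apply/ltW.
    by apply: lt_trans qr _; case/andP: (uP n).
  exists (Num.bound (ratr q - r)^-1) => n Nn; apply/upperP; rewrite finvK -qE.
  rewrite lerMn2r (ler_rat L) -(ler_rat R); apply/orP; right; apply/ltW.
  case/andP: (uP n) => _ /lt_le_trans; apply; rewrite -lerBrDl.
  have rq0 : 0 < ratr q - r by rewrite subr_gt0.
  rewrite invf_ple ?posrE ?ltr0n //; apply: ltW.
  apply: lt_le_trans (archi_boundP _) _; first by rewrite invr_ge0 ltW.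
  by rewrite ler_nat ltnW.
exists (f x) => e e0.
have lo q : ratr q < r -> ratr q <= f x.
  move=> qr; have [m [m' [d [d0 qE]]]] := rat_form q.
  have /xP/lowerP : Phi (lower m m' d) by exists q, m, m', d; split=> //; left.
  by rewrite -qE lerMn2r eqn0Ngt d0.
have hi q : r < ratr q -> f x <= ratr q.
  move=> qr; have [m [m' [d [d0 qE]]]] := rat_form q.
  have /xP/upperP : Phi (upper m m' d) by exists q, m, m', d; split=> //; right.
  by rewrite -qE lerMn2r eqn0Ngt d0.
have e0R : 0 < ratr e :> R by rewrite ltr0q.
have [a] : exists a : rat, ratr a \in `]r - ratr e, r[ by apply: rat_in_itvoo; lra.
rewrite in_itv /= => /andP[ea ar].
have [b] : exists b : rat, ratr b \in `]r, ratr a + ratr e[ by apply: rat_in_itvoo; lra.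
rewrite in_itv /= => /andP[rb be].
have bea : ratr b < ratr a + ratr e :> L.
  by rewrite -rmorphD ltr_rat -(ltr_rat R) rmorphD.
exists a; have := lo _ ar; have := hi _ rb => ??; split=> /=.
- by rewrite ltr_norml; apply/andP; split; lra.
- by rewrite ltr_norml; apply/andP; split; lra.
Qed.

(** The type says that [x] is nonzero, nonnegative and satisfies [d x <= 1] for each [d]; the
    sequence [1 / (n + 1)] satisfies each condition eventually. *)
Let infinitesimal : exists2 eps : L, eps != 0 & @standard_part R L (0, eps).
Proof.
pose Phi : set (GRing.formula K) := [set g | g = (~ ('X_0 == 0%:R))%T \/
  (g = lower 0 0 1) \/ (exists d : nat, g = upper 1 0 d)].
have [||x xP] :=
    saturated_limit (Phi := Phi) (u := fun n => finv n.+1%:R^-1) sat.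
- by move=> _ [->|[->|[d ->]]] //=; do !split; auto.
- move=> _ [->|[->|[d ->]]].
  + exists 0%N => n _ /= E; have := congr1 f E; rewrite finvK rmorph_nat.
    by apply/eqP; rewrite invr_eq0 pnatr_eq0.
  + exists 0%N => n _; apply/lowerP; rewrite finvK subrr mulr1n.
    by rewrite invr_ge0 ler0n.
  + exists d => n dn; apply/upperP; rewrite finvK subr0 -mulr_natl.
    by rewrite ler_pdivrMr ?ltr0n // mul1r ler_nat leqW.
have x0 : f x != 0.
  have : Phi (~ ('X_0 == 0%:R))%T by left.
  by move=> /xP /= h; apply/eqP => fx0; apply: h; apply: (bij_inj fbij); rewrite fx0 rmorph_nat.
have xge0 : 0 <= f x.
  have /xP/lowerP : Phi (lower 0 0 1) by right; left.
  by rewrite subrr mulr1n.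
have xle d : f x *+ d <= 1.
  have /xP/upperP : Phi (upper 1 0 d) by right; right; exists d.
  by rewrite subr0.
exists (f x) => // e e0; exists 0; rewrite /= rmorph0 !subr0 normr0 ltr0q e0; split=> //.
rewrite rmorph0 subr0 ger0_norm //.
have eV : 0 <= e^-1 by rewrite invr_ge0 ltW.
have := archi_boundP eV; set d := Num.bound _ => ed.
have d0 : (0 < d)%N by rewrite -(ltr0n rat); exact: le_lt_trans ed.
have : ratr e^-1 < d%:R :> L by rewrite -(ratr_nat L d) ltr_rat.
rewrite fmorphV /= => h; have := xle d; rewrite -mulr_natr => h2.
have re0 : 0 < ratr e :> L by rewrite ltr0q.
rewrite -(ltr_pM2r (x := d%:R)) ?ltr0n //; apply: le_lt_trans h2 _.
by rewrite -ltr_pdivrMl // mulr1.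
Qed.

Lemma real_closed_saturated_embeddings_rcf :
  power_continuum #<= @field_embeddings R L.
Proof.
have [eps e0 Ve] := infinitesimal.
exact: rcf_embeddings near_ratr e0 Ve.
Qed.

Lemma field_embeddings_pullback :
  @field_embeddings R L #<= @field_embeddings R K.
Proof.
have finvI : cancel f finv by move=> x; apply: (bij_inj fbij); rewrite finvK.
have hB : zmod_morphism finv by exact: (can2_zmod_morphism finvI finvK).
have hM : monoid_morphism finv by exact: (can2_monoid_morphism finvI finvK).
pose g : {rmorphism L -> K} := HB.pack finv
  (GRing.isZmodMorphism.Build L K finv hB) (GRing.isMonoidMorphism.Build L K finv hM).
apply: (@injective_card_le (R -> L) (R -> K) _ _ (fun h => finv \o h)) => [_ [h ->]|h h' _ _ E].
  by exists [the {rmorphism R -> K} of g \o h].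
apply/funext => x; have := congr1 (fun k : R -> K => f (k x)) E.
by rewrite /= !finvK.
Qed.

End RealClosedSaturated.

Lemma real_closed_embeddings (R : realType) (K : fieldType) :
  real_closed K -> aleph1_saturated K ->
  power_continuum #<= @field_embeddings R K.
Proof.
move=> [L [f fbij]] sat; apply: card_le_trans (field_embeddings_pullback R fbij).
exact: real_closed_saturated_embeddings_rcf fbij sat.
Qed.

(** * Overspill and Skolem bounds *)

Section Overspill.
Variables (I : Type) (F : set_system I).
Context {FU : UltraFilter F}.

Definition infinite_index (f : I -> nat) : Prop := forall n, F [set i | (n <= f i)%N].

Lemma filter_forall_le (P : nat -> set I) n :
  (forall m, (m <= n)%N -> F (P m)) -> F [set i | forall m, (m <= n)%N -> P m i].
Proof.
elim: n => [|n IH] h.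
  by apply: filterS (h 0%N (leqnn _)) => i Pi m; rewrite leqn0 => /eqP ->.
apply: filterS2 (IH _) (h n.+1 (leqnn _)) => [i lo hi m|m mn].
  by rewrite leq_eqVlt => /orP[/eqP ->//|]; rewrite ltnS; exact: lo.
by apply: h; exact: leqW.
Qed.

(** The least [k] such that [i] is outside [A k] is at least [n] almost everywhere, because almost
    all [i] lie in [A 0], ..., [A n]. *)
Lemma countably_incomplete_index :
  countably_incomplete F -> exists g, infinite_index g.
Proof.
move=> [A [FA FnA]].
have FC : F (~` \bigcap_k A k).
  by have [//|] := in_ultra_setVsetC (\bigcap_k A k) FU.
have ex i : (~` \bigcap_k A k) i -> exists k, `[< ~ A k i >].
  by move=> h; apply: contrapT => ne; apply: h => k _; apply: contrapT => nA; apply: ne;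
    exists k; apply/asboolP.
exists (fun i => if pselect ((~` \bigcap_k A k) i) is left h then ex_minn (ex i h) else 0%N).
move=> n; have FAn := @filter_forall_le A n (fun m _ => FA m).
apply: filterS2 FC FAn => i Ci An /=; case: pselect => // h.
case: ex_minnP => m /asboolP nAm _; rewrite leqNgt; apply/negP => mn.
by apply: nAm; apply: An; exact: ltnW.
Qed.

(** The index [nu i] is the largest [n] up to which all conditions hold at [i], capped by an
    infinite [g i] so that the maximum exists. *)
Lemma overspill (E : nat -> set I) :
  countably_incomplete F -> (forall n, F (E n)) ->
  exists nu, infinite_index nu /\ F [set i | forall m, (m <= nu i)%N -> E m i].
Proof.
move=> /countably_incomplete_index[g gP] FE.
pose Q i n := `[< forall m, (m <= n)%N -> E m i >].
pose nu i := (\max_(n < (g i).+1 | Q i n) n)%N.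
exists nu; split=> [n|].
  apply: filterS2 (gP n) (@filter_forall_le E n (fun m _ => FE m)) => i gn En /=.
  apply: (@leq_bigmax_cond _ (fun k : 'I_(g i).+1 => Q i k) (fun k => nat_of_ord k)
    (Ordinal (gn : (n < (g i).+1)%N))).
  exact/asboolP.
apply: filterS (FE 0%N) => i E0 /=.
have Q0 : Q i 0%N by apply/asboolP => m; rewrite leqn0 => /eqP ->.
have [|j Qj jE] := @eq_bigmax_cond _ (fun k : 'I_(g i).+1 => Q i k) (fun k => nat_of_ord k).
  by apply/card_gt0P; exists ord0.
by have -> : nu i = j; [exact: jE|exact/asboolP].
Qed.

(** Overspill for the conditions [Om n <= f]: however fast [Om] grows, it stays below [f] at some
    infinite argument. *)
Lemma infinite_index_le (f : I -> nat) (Om : nat -> nat) :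
  countably_incomplete F -> infinite_index f ->
  exists nu, infinite_index nu /\ F [set i | (Om (nu i) <= f i)%N].
Proof.
move=> ci fP; have [nu [nuP h]] := overspill ci (fun n => fP (Om n)).
by exists nu; split=> //; apply: filterS h => i; apply.
Qed.

(* A cut below [d] that is closed under countably many functions [w l]; its
   lower bounds [M k] climb down an iteration of the maximum of the [w l]. *)
Lemma closed_cut (d : I -> nat) (w : nat -> nat -> nat) :
  countably_incomplete F -> infinite_index d ->
  exists (M : nat -> I -> nat) (nu : I -> nat),
    [/\ forall k i, (M k.+1 i <= M k i)%N, F [set i | (M 0 i <= d i)%N],
      infinite_index nu, forall k i, (nu i <= M k i)%N &
      forall l k, F [set i | forall n, (n <= M k.+1 i)%N -> (w l n <= M k i)%N]].
Proof.
move=> ci dP.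
pose W m x := maxn x (\max_(l < m.+1) \max_(y < x.+1) w l y).
have Wx m x : (x <= W m x)%N by rewrite leq_maxl.
have Ww m x l y : (l <= m)%N -> (y <= x)%N -> (w l y <= W m x)%N.
  move=> lm yx; rewrite leq_max; apply/orP; right.
  apply: leq_trans (@leq_bigmax _ (fun l : 'I_m.+1 => \max_(y < x.+1) w l y)
    (Ordinal (lm : (l < m.+1)%N))).
  exact: (@leq_bigmax _ (fun y : 'I_x.+1 => w l y) (Ordinal (yx : (y < x.+1)%N))).
(* A diagonal choice: even [nu] iterations of [W nu] from [nu] stay below [d]. The bound [M k] stops
   [k] steps early, so once [l] and [k] are below [nu], one application of [w l] leads from below
   [M k.+1] to below [M k]. *)
have [nu [nuP nud]] := infinite_index_le (fun n => iter n (W n) n) ci dP.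
exists (fun k i => iter (nu i - k) (W (nu i)) (nu i)), nu; split=> //.
- move=> k i; rewrite subnS; case: (nu i - k)%N => //= m.
- by apply: filterS nud => i; rewrite /= subn0.
- by move=> k i; elim: (nu i - k)%N => //= m IH; exact: leq_trans IH (Wx _ _).
move=> l k; apply: filterS2 (nuP l) (nuP k.+1) => i /= lnu knu n.
by rewrite subnS -[(nu i - k)%N in X in _ -> X]prednK ?subn_gt0 //=; exact: Ww.
Qed.

End Overspill.

(** A countable syntax without constants, which can be interpreted in [N] and in its extension
    alike; parameters are passed as values of variables. *)
Inductive fo : Type :=
  | FEq of pexp nat & pexp nat
  | FNot of fo
  | FAnd of fo & fo
  | FEx of nat & fo.

Fixpoint sat (K : nzRingType) (v : nat -> K) (f : fo) : Prop :=
  match f with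
  | FEq p q => peval v p = peval v q
  | FNot g => ~ sat v g
  | FAnd g h => sat v g /\ sat v h
  | FEx j g => exists x, sat (update v j x) g
  end.

Fixpoint pbound (p : pexp nat) : nat :=
  match p with
  | PVar j => j.+1
  | PNat _ => 0
  | POpp q => pbound q
  | PAdd q r | PMul q r => maxn (pbound q) (pbound r)
  end.

Fixpoint fbound (f : fo) : nat :=
  match f with
  | FEq p q => maxn (pbound p) (pbound q)
  | FNot g => fbound g
  | FAnd g h => maxn (fbound g) (fbound h)
  | FEx j g => fbound g
  end.

Lemma pvars_bound p j : pvars p j -> (j < pbound p)%N.
Proof.
elim: p => //= [k ->//|q IHq r IHr|q IHq r IHr] [/IHq|/IHr];
  by rewrite leq_max => ->; rewrite ?orbT.
Qed.

Lemma sat_ext (K : nzRingType) (v w : nat -> K) f :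
  (forall j, (j < fbound f)%N -> v j = w j) -> sat v f <-> sat w f.
Proof.
elim: f v w => [p q|g IH|g IHg h IHh|j g IH] v w vw /=.
- rewrite (@peval_ext _ _ v w p) ?(@peval_ext _ _ v w q) // => j /pvars_bound jb;
    by apply: vw; rewrite /= leq_max jb ?orbT.
- by have := IH v w vw; tauto.
- have := IHg v w; have := IHh v w => hh hg.
  have {}hh := hh (fun j jb => vw j (leq_trans jb (leq_maxr _ _))).
  have {}hg := hg (fun j jb => vw j (leq_trans jb (leq_maxl _ _))).
  tauto.
- have E x : sat (update v j x) g <-> sat (update w j x) g.
    by apply: IH => k kb; rewrite /update; case: pselect => //= _; rewrite vw.
  by split=> -[x /E]; exists x.
Qed.

Lemma fo_code : exists c : fo -> nat, injective c.
Proof.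
have [pr prI] := infinite_pairing (@inj_id nat).
have [c cI] := pexp_code (@inj_id nat) (@inj_id nat) prI.
exists (fix d f := match f with
  | FEq p q => pr 0 (pr (c p) (c q))
  | FNot g => pr 1 (d g)
  | FAnd g h => pr 2 (pr (d g) (d h))
  | FEx j g => pr 3 (pr j (d g)) end)%N.
elim=> [p q|g IH|g IHg h IHh|j g IH] [p' q'|g'|g' h'|j' g'] /prI[//= _].
- by move=> /prI[/cI -> /cI ->].
- by move=> /IH ->.
- by move=> /prI[/IHg -> /IHh ->].
- by move=> /prI[-> /IH ->].
Qed.

Section SkolemBound.
Variables (N : nzRingType) (code : N -> nat).
Hypothesis codeI : injective code.

(** Only the first [fbound f] values matter, and injectivity of [code] leaves finitely many choices
    for them; the bound is the maximum over one witness for each choice. *)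
Lemma skolem_bound_at (f : fo) (n : nat) : exists b, forall j (v : nat -> N),
  (forall k, (k < fbound f)%N -> (code (v k) <= n)%N) -> sat v (FEx j f) ->
  (j < fbound f)%N ->
  exists2 x, (code x <= b)%N & sat (update v j x) f.
Proof.
have [dec decK] : exists dec, cancel code dec.
  have [|dec dP] := @choice_in nat N (range code) (fun c x => code x = c) 0.
    by move=> _ [x _ <-]; exists x.
  by exists dec => x; apply: codeI; apply: dP; exists x.
pose m := fbound f.
pose val (t : {ffun 'I_m -> 'I_n.+1}) (k : nat) : N :=
  if insub k is Some k' then dec (t k') else 0.
have /choice[wit witP] : forall z : {ffun 'I_m -> 'I_n.+1} * 'I_m, exists x : N,
    sat (val z.1) (FEx z.2 f) -> sat (update (val z.1) z.2 x) f.
  move=> z; have [[x xP]|nex] := pselect (sat (val z.1) (FEx z.2 f)); first by exists x.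
  by exists 0.
exists (\max_z code (wit z))%N => j v vn vex jm.
pose t : {ffun 'I_m -> 'I_n.+1} := [ffun k : 'I_m => inord (code (v k))].
have tv k : (k < m)%N -> val t k = v k.
  by move=> km; rewrite /val insubT /= ffunE inordK ?ltnS ?vn //= decK.
pose z := (t, Ordinal jm); exists (wit z).
  exact: (@leq_bigmax _ (fun z => code (wit z)) z).
have E x : sat (update v j x) f <-> sat (update (val t) j x) f.
  by apply: sat_ext => k km; rewrite /update; case: pselect => //= _; rewrite tv.
by apply/E/(witP z); have [x /E] := vex; exists x.
Qed.

Lemma skolem_bound : exists w : nat -> nat -> nat, forall (f : fo) (j : nat),
  exists l, forall n (v : nat -> N),
    (forall k, (k < fbound f)%N -> (code (v k) <= n)%N) -> sat v (FEx j f) ->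
    exists2 x, (code x <= w l n)%N & sat (update v j x) f.
Proof.
have [c cI] := fo_code.
have /choice[b bP] : forall z : fo * nat, exists b, forall j (v : nat -> N),
    (forall k, (k < fbound z.1)%N -> (code (v k) <= z.2)%N) -> sat v (FEx j z.1) ->
    (j < fbound z.1)%N -> exists2 x, (code x <= b)%N & sat (update v j x) z.1.
  by move=> [f n]; exact: skolem_bound_at.
have [|dec decP] := @choice_in nat fo (range c) (fun l f => c f = l)
    (FEq (PNat 0) (PNat 0)).
  by move=> _ [f _ <-]; exists f.
have decK f : dec (c f) = f by apply: cI; apply: decP; exists f.
exists (fun l n => maxn (b (dec l, n)) (code 0)) => f j; exists (c f) => n v vn vf.
rewrite decK; have [jb|jb] := ltnP j (fbound f).
  have [x xb xf] := bP (f, n) j v vn vf jb.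
  by exists x => //; rewrite leq_max xb.
(* The quantified variable does not occur in [f], so any witness will do; the bound was made at
   least [code 0] for this case. *)
exists 0; first by rewrite leq_maxr.
have [x] := vf; apply: (proj1 (sat_ext _)) => k kb; rewrite !update_neq // => E;
  by move: kb; rewrite E ltnNge jb.
Qed.

End SkolemBound.

(** * Internal sets *)

Lemma vpair_inj (X : Type) n (a b a' b' : superstr X n) :
  vpair a b = vpair a' b' -> a = a' /\ b = b'.
Proof.
pose one (x : superstr X n) : superstr X n.+1 := inr [set x].
pose two (x y : superstr X n) : superstr X n.+1 := inr [set x; y].
have sub2 x y z : one x = two y z -> x = y /\ x = z.
  move=> [h]; have hy : [set x] y by rewrite h; left.
  by have hz : [set x] z by rewrite h; right.
have in1 (x y z w : superstr X n) : vpair x y = vpair z w ->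
    x = z /\ (y = x \/ y = w).
  move=> [h].
  have h1 : one x = one z \/ one x = two z w.
    by have : [set one x; two x y] (one x) by [left]; rewrite h.
  have h2 : two x y = one z \/ two x y = two z w.
    by have : [set one x; two x y] (two x y) by [right]; rewrite h.
  have xz : x = z by case: h1 => [[k]|/sub2[]//]; have : [set x] x by []; rewrite k.
  split=> //; case: h2 => [/esym/sub2[<- <-]|[k]]; first by left.
  by have : [set x; y] y by [right]; rewrite k xz.
move=> E; have [aa' bE] := in1 _ _ _ _ E; have [_ b'E] := in1 _ _ _ _ (esym E).
split=> //; case: bE => // ba; case: b'E => // b'a'.
by rewrite ba b'a' aa'.
Qed.

Section Ultravalues.
Context (I : Type) (F : set_system I) {FU : UltraFilter F}.

Lemma ultra_or (A B : set I) : F (A `|` B) -> F A \/ F B.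
Proof.
move=> AB; have [FA|nA] := in_ultra_setVsetC A FU; first by left.
by right; apply: filterS2 AB nA => i [].
Qed.

Lemma ultraval_inr n (B : I -> set (superstr nat n)) :
  ultraval (F := F) (fun i => inr (B i) : superstr nat n.+1) =
  inr [set y | exists2 g, F [set i | B i (g i)] & y = ultraval (F := F) g].
Proof.
rewrite /=; case: asboolP => // h.
by have [i [a]] := filter_ex h.
Qed.

Lemma ultraval_ae n (f g : I -> superstr nat n) :
  F [set i | f i = g i] -> ultraval (F := F) f = ultraval (F := F) g.
Proof.
move=> fg; case: n f g fg => [|n] f g fg /=; first exact/hpiE.
have atomE : `[< F [set i | exists a, f i = inl a] >] =
             `[< F [set i | exists a, g i = inl a] >].
  by apply/asboolP/asboolP; apply: filterS2 fg => i /= ->.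
rewrite atomE; case: ifP => _; congr (_ _).
  by apply/hpiE; apply: filterS fg => i /= ->.
apply/funext => y; apply/propext.
by split=> -[h Fh ->]; exists h => //; apply: filterS2 fg Fh => i /= ->.
Qed.

Lemma ultraval_set1 n (a : I -> superstr nat n) :
  ultraval (F := F) (fun i => inr [set a i] : superstr nat n.+1) = inr [set ultraval (F := F) a].
Proof.
rewrite ultraval_inr; congr inr; apply/seteqP; split=> [_ [g Fg ->]|_ ->].
  exact: ultraval_ae.
by exists a => //; apply: filterS filterT.
Qed.

Lemma ultraval_set2 n (a b : I -> superstr nat n) :
  ultraval (F := F) (fun i => inr [set a i; b i] : superstr nat n.+1) =
  inr [set ultraval (F := F) a; ultraval (F := F) b].
Proof.
rewrite ultraval_inr; congr inr; apply/seteqP; split=> [_ [g Fg ->]|_ [->|->]].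
- by have [h|h] := @ultra_or [set i | g i = a i] [set i | g i = b i] Fg;
    [left|right]; exact: ultraval_ae.
- by exists a => //; apply: filterS filterT => i _; left.
- by exists b => //; apply: filterS filterT => i _; right.
Qed.

Lemma ultraval_vpair n (a b : I -> superstr nat n) :
  ultraval (F := F) (fun i => vpair (a i) (b i)) = vpair (ultraval (F := F) a) (ultraval (F := F) b).
Proof. by rewrite /vpair ultraval_set2 ultraval_set1 ultraval_set2. Qed.

(** The value lies in the image under [star] of a whole level of the superstructure; hence every
    family of sets of one level defines an internal set. *)
Lemma internal_ultraval n (f : I -> superstr nat n) : internal (ultraval (F := F) f).
Proof.
exists 0%N, (inr setT : superstr nat (0 + n).+1).
rewrite /star ultraval_inr /=; exists f => //; exact: filterS filterT.
Qed.

End Ultravalues.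

(** * The elementary subfield cut out of an ultrapower *)

Lemma subfield_valM (K : fieldType) (S : divringClosed K) (x y : subfield S) :
  val (x * y) = val x * val y.
Proof. exact: (rmorphM (\val : {rmorphism subfield S -> K})). Qed.

Section Translation.
Variables (K : fieldType) (A : set K) (idx : K -> nat).

(* The variable [i] becomes [2i] and the constant [c] becomes the variable [2 (idx c) + 1]. *)
Fixpoint trans_term (t : GRing.term K) : pexp nat :=
  match t with
  | GRing.Var i => PVar i.*2
  | GRing.Const c => PVar (idx c).*2.+1
  | GRing.NatConst n => PNat n
  | GRing.Add t1 t2 => PAdd (trans_term t1) (trans_term t2)
  | GRing.Opp t1 => POpp (trans_term t1)
  | GRing.NatMul t1 n => PMul (trans_term t1) (PNat n)
  | GRing.Mul t1 t2 => PMul (trans_term t1) (trans_term t2)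
  | GRing.Inv _ => PNat 0
  | GRing.Exp t1 n => iter n (PMul (trans_term t1)) (PNat 1)
  end.

Fixpoint trans (f : GRing.formula K) : fo :=
  match f with
  | GRing.Bool b => FEq (PNat b) (PNat 1)
  | GRing.Equal t1 t2 => FEq (trans_term t1) (trans_term t2)
  | GRing.Unit _ => FEq (PNat 0) (PNat 0)
  | GRing.And f1 f2 => FAnd (trans f1) (trans f2)
  | GRing.Or f1 f2 => FNot (FAnd (FNot (trans f1)) (FNot (trans f2)))
  | GRing.Implies f1 f2 => FNot (FAnd (trans f1) (FNot (trans f2)))
  | GRing.Not f1 => FNot (trans f1)
  | GRing.Exists i f1 => FEx i.*2 (trans f1)
  | GRing.Forall i f1 => FNot (FEx i.*2 (FNot (trans f1)))
  end.

Definition interprets (v : nat -> K) (s : seq K) : Prop :=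
  (forall i, v i.*2 = s`_i) /\ forall c, A c -> v (idx c).*2.+1 = c.

Lemma interprets_update v s i x :
  interprets v s -> interprets (update v i.*2 x) (set_nth 0 s i x).
Proof.
move=> [vs vc]; split=> [j|c Ac].
  rewrite nth_set_nth /=; case: eqVneq => [->|/eqP ji]; first by rewrite update_eq.
  by rewrite update_neq // => /double_inj.
rewrite update_neq ?vc // => E; have := congr1 odd E.
by rewrite /= !odd_double.
Qed.

Lemma trans_termP V t v s : interprets v s -> ring_term_over A V t ->
  peval v (trans_term t) = GRing.eval s t.
Proof.
move=> [vs vc]; elim: t => //= [t IHt u IHu [? ?]|t IHt ?|t IHt n ?|t IHt u IHu [? ?]|t IHt n ?].
- by rewrite IHt ?IHu.
- by rewrite IHt.
- by rewrite IHt ?mulr_natr.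
- by rewrite IHt ?IHu.
- by elim: n => [|n IH] //=; rewrite IHt // exprS -IH.
Qed.

Lemma transP V f v s : interprets v s -> ring_formula_over A V f ->
  sat v (trans f) <-> GRing.holds s f.
Proof.
elim: f V v s => //=.
- by move=> b V v s _ _; case: b => /=; split=> // /eqP; rewrite eq_sym oner_eq0.
- by move=> t u V v s vs [tA uA]; rewrite (trans_termP vs tA) (trans_termP vs uA).
- move=> f IHf g IHg V v s vs [fA gA].
  by have := IHf _ _ _ vs fA; have := IHg _ _ _ vs gA; tauto.
- move=> f IHf g IHg V v s vs [fA gA].
  have := IHf _ _ _ vs fA; have := IHg _ _ _ vs gA.
  have := pselect (sat v (trans f)); have := pselect (sat v (trans g)); tauto.
- move=> f IHf g IHg V v s vs [fA gA].
  have := IHf _ _ _ vs fA; have := IHg _ _ _ vs gA.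
  have := pselect (sat v (trans f)); have := pselect (sat v (trans g)); tauto.
- by move=> f IHf V v s vs fA; have := IHf _ _ _ vs fA; tauto.
- move=> i f IHf V v s vs fA.
  by split=> -[x h]; exists x; apply/(IHf _ _ _ (interprets_update i x vs) fA).
- move=> i f IHf V v s vs fA; split=> [h x|h [x]].
    apply: contrapT => nh; apply: h; exists x.
    by move/(IHf _ _ _ (interprets_update i x vs) fA).
  by apply; apply/(IHf _ _ _ (interprets_update i x vs) fA).
Qed.

End Translation.

(** * The subfield given by a cut of codes *)

Section PartialEmbedding.
Context (I : Type) (F : set_system I) {FU : UltraFilter F}.
Variables (p : hypernat F) (hp : hyperprime p).
Variables (N : fieldType) (code : N -> nat) (e : {rmorphism N -> hyperFp hp}).
Hypothesis codeI : injective code.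

Definition coord (i : I) (r : N) : nat := repr (val (e r)) i.

Definition hom_at (i : I) (r s t : N) : Prop :=
  [/\ r <> s -> coord i r <> coord i s, (coord i r < repr p i)%N,
    t = r + s -> coord i t = ((coord i r + coord i s) %% repr p i)%N &
    t = r * s -> coord i t = ((coord i r * coord i s) %% repr p i)%N].

Definition partial_hom (m : nat) : set I := [set i | forall r s t,
  (code r <= m)%N -> (code s <= m)%N -> (code t <= m)%N -> hom_at i r s t].

Lemma hom_at_ae r s t : F [set i | hom_at i r s t].
Proof.
have F1 : F [set i | r <> s -> coord i r <> coord i s].
  have [->|rs] := eqVneq r s; first by apply: filterS filterT => i _ [].
  have [//|h] := in_ultra_setVsetC [set i | r <> s -> coord i r <> coord i s] FU.
  case/eqP: rs; apply: (fmorph_inj e); apply: fp_eqP; apply: filterS h => i /= h.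
  by apply: contrapT => ne; apply: h.
have F2 : F [set i | (coord i r < repr p i)%N] := fp_repr_lt (e r).
have F3 : F [set i | t = r + s ->
    coord i t = ((coord i r + coord i s) %% repr p i)%N].
  have [->|ts] := eqVneq t (r + s); last first.
    by apply: filterS filterT => i _ /= E; rewrite E eqxx in ts.
  by apply: filterS (fp_addE (e r) (e s)) => i /= E _; rewrite /coord rmorphD -E.
have F4 : F [set i | t = r * s ->
    coord i t = ((coord i r * coord i s) %% repr p i)%N].
  have [->|ts] := eqVneq t (r * s); last first.
    by apply: filterS filterT => i _ /= E; rewrite E eqxx in ts.
  by apply: filterS (fp_mulE (e r) (e s)) => i /= E _; rewrite /coord rmorphM -E.
apply: filterS (filterI (filterI F1 F2) (filterI F3 F4)) => i [[? ?] [? ?]].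
by split.
Qed.

(** For each triple the conditions hold almost everywhere because [e] is a homomorphism of fields,
    and only finitely many triples have codes at most [m]. *)
Lemma partial_hom_ae m : F (partial_hom m).
Proof.
pose P a b c : set I := [set i | forall r s t,
  code r = a -> code s = b -> code t = c -> hom_at i r s t].
have FP a b c : F (P a b c).
  have [[r [s [t [ra sb tc]]]]|nex] :=
      pselect (exists r s t, [/\ code r = a, code s = b & code t = c]).
    apply: filterS (hom_at_ae r s t) => i h r' s' t' /= r'a s'b t'c.
    have -> : r' = r by apply: codeI; rewrite ra.
    have -> : s' = s by apply: codeI; rewrite sb.
    by have -> : t' = t by apply: codeI; rewrite tc.
  apply: filterS filterT => i _ r s t ra sb tc; exfalso; apply: nex.
  by exists r, s, t.
have FP3 : F [set i | forall a, (a <= m)%N -> forall b, (b <= m)%N ->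
    forall c, (c <= m)%N -> P a b c i].
  do 3![apply: filter_forall_le => ? _]; exact: FP.
apply: filterS FP3 => i h r s t rm sm tm; exact: (h _ rm _ sm _ tm r s t).
Qed.

Variables (M : nat -> I -> nat) (w : nat -> nat -> nat).
Hypotheses (Mdec : forall k i, (M k.+1 i <= M k i)%N)
  (Mhom : F [set i | partial_hom (M 0 i) i])
  (Mw : forall l k, F [set i | forall n, (n <= M k.+1 i)%N -> (w l n <= M k i)%N])
  (Minf : forall k, infinite_index F (M k))
  (wP : forall f j, exists l, forall n (v : nat -> N),
    (forall k, (k < fbound f)%N -> (code (v k) <= n)%N) -> sat v (FEx j f) ->
    exists2 x, (code x <= w l n)%N & sat (update v j x) f).

Lemma M_le k l i : (k <= l)%N -> (M l i <= M k i)%N.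
Proof.
move=> /subnKC <-; elim: (l - k)%N => [|n IH]; first by rewrite addn0.
by rewrite addnS; exact: leq_trans (Mdec _ _) IH.
Qed.

Definition bounded (xi : I -> N) : Prop := forall k, F [set i | (code (xi i) <= M k i)%N].

Lemma bounded_ae xi zeta : F [set i | xi i = zeta i] -> bounded xi -> bounded zeta.
Proof. by move=> h bxi k; apply: filterS2 h (bxi k) => i /= ->. Qed.

(** The witness is chosen once, with its code below the Skolem bound of the arguments. For every [k]
    these lie below [M k.+1], so the witness lies below [M k]. *)
Lemma bounded_skolem (f : fo) j (v : nat -> I -> N) :
  (forall k, bounded (v k)) -> F [set i | sat (v^~ i) (FEx j f)] ->
  exists2 xi, bounded xi & F [set i | sat (update (v^~ i) j (xi i)) f].
Proof.
move=> bv Fsat; have [l lP] := wP f j.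
pose n i := (\max_(k < fbound f) code (v k i))%N.
have /choice[xi xiP] : forall i, exists x : N, sat (v^~ i) (FEx j f) ->
    (code x <= w l (n i))%N /\ sat (update (v^~ i) j x) f.
  move=> i; have [h|nh] := pselect (sat (v^~ i) (FEx j f)); last by exists 0.
  have [k kf|x xw xf] := lP (n i) (v^~ i) _ h; last by exists x.
  exact: (@leq_bigmax _ (fun k : 'I_(fbound f) => code (v k i)) (Ordinal kf)).
exists xi; last by apply: filterS Fsat => i /xiP[].
move=> k.
have Fn : F [set i | forall m, (m <= fbound f)%N -> (code (v m i) <= M k.+1 i)%N].
  by apply: filter_forall_le => m _; exact: bv.
apply: filterS2 (filterI Fsat Fn) (Mw l k) => i [/xiP[xw _] vn] wM.
apply: leq_trans xw (wM _ _); apply/bigmax_leqP => m _; apply: vn; exact: ltnW.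
Qed.

(** An operation with a definable graph preserves the cut, since its value is the only possible
    Skolem witness. *)
Lemma bounded_op (f : fo) (op : N -> N -> N) (g h : I -> N) :
  (forall x y z, sat (update (update (update (fun=> 0) 0%N x) 1%N y) 2 z) f ->
     z = op x y) ->
  (forall x y, sat (update (update (update (fun=> 0) 0%N x) 1%N y) 2 (op x y)) f) ->
  (fbound f <= 3)%N -> bounded g -> bounded h -> bounded (fun i => op (g i) (h i)).
Proof.
move=> fop opf fb bg bh.
pose v k := if k is 0%N then g else h.
have E i z : sat (update (v^~ i) 2 z) f <->
    sat (update (update (update (fun=> 0) 0%N (g i)) 1%N (h i)) 2 z) f.
  apply: sat_ext => k /leq_trans/(_ fb); case: k => [|[|[|]]] // _;
    by rewrite /update; do ?case: pselect.
have bv k : bounded (v k) by case: k.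
have Fv : F [set i | sat (v^~ i) (FEx 2 f)].
  by apply: filterS filterT => i _; exists (op (g i) (h i)); apply/E.
have [xi bxi xif] := bounded_skolem bv Fv.
by apply: bounded_ae bxi; apply: filterS xif => i /E/fop.
Qed.

Let updE := (@update_eq nat N, fun v x => @update_neq nat N v 2 x 0%N (fun h => O_S _ h),
  fun v x => @update_neq nat N v 1%N x 0%N (fun h => O_S _ h),
  fun v x => @update_neq nat N v 2 x 1%N (fun h => O_S _ (eq_add_S _ _ h))).

Lemma boundedD g h : bounded g -> bounded h -> bounded (fun i => g i + h i).
Proof.
apply: (@bounded_op (FEq (PVar 2) (PAdd (PVar 0) (PVar 1)))) => //= [x y z|x y];
  by rewrite !updE.
Qed.

Lemma boundedM g h : bounded g -> bounded h -> bounded (fun i => g i * h i).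
Proof.
apply: (@bounded_op (FEq (PVar 2) (PMul (PVar 0) (PVar 1)))) => //= [x y z|x y];
  by rewrite !updE.
Qed.

Lemma bounded_cst c : bounded (fun=> c).
Proof. by move=> k; exact: Minf. Qed.

Lemma boundedN g : bounded g -> bounded (fun i => - g i).
Proof.
move=> bg; apply: (@bounded_op (FEq (PAdd (PVar 2) (PVar 0)) (PNat 0)) (fun x _ => - x)
  g g) => //= [x y z|x y]; rewrite !updE.
  by move=> /eqP; rewrite addr_eq0 => /eqP.
by rewrite addNr.
Qed.

Lemma boundedV g : bounded g -> bounded (fun i => (g i)^-1).
Proof.
(* The formula says that [x] and [z] are both [0] or [x * z = 1], which is the graph of the total
   inverse. *)
move=> bg; apply: (@bounded_op (FNot (FAnd
    (FNot (FAnd (FEq (PVar 0) (PNat 0)) (FEq (PVar 2) (PNat 0))))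
    (FNot (FEq (PMul (PVar 0) (PVar 2)) (PNat 1)))))
  (fun x _ => x^-1) g g) => //= [x y z|x y]; rewrite !updE.
  move=> h; apply: contrapT => ne; apply: h; split=> [[x0 z0]|xz].
    by apply: ne; rewrite x0 z0 invr0.
  by apply: ne; rewrite (mulr1_eq xz).
move=> [n0 n1]; have [x0|x0] := eqVneq x 0.
  by apply: n0; rewrite x0 invr0.
by apply: n1; rewrite mulfV.
Qed.

Lemma bounded_partial_hom (xi zeta tau : I -> N) :
  bounded xi -> bounded zeta -> bounded tau ->
  F [set i | hom_at i (xi i) (zeta i) (tau i)].
Proof.
move=> /(_ 0%N) bx /(_ 0%N) bz /(_ 0%N) bt.
apply: filterS2 (filterI bx bz) (filterI bt Mhom) => i [xm zm] [tm]; exact.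
Qed.

Definition repr_by (xi : I -> N) (x : hyperFp hp) : Prop :=
  F [set i | repr (val x) i = coord i (xi i)].

Lemma repr_by_uniq xi x y : repr_by xi x -> repr_by xi y -> x = y.
Proof. by move=> hx hy; apply: fp_eqP; apply: filterS2 hx hy => i /= -> ->. Qed.

Lemma repr_by_ae xi zeta x : F [set i | xi i = zeta i] -> repr_by xi x -> repr_by zeta x.
Proof. by move=> h hx; apply: filterS2 h hx => i /= ->. Qed.

Lemma repr_by_ex xi : bounded xi -> exists x, repr_by xi x.
Proof.
move=> bx; pose h := \pi_(@hypernat I F FU) (fun i => coord i (xi i)).
have hlt_p : hlt h p.
  rewrite -[p]reprK; apply/hltE.
  by apply: filterS (bounded_partial_hom bx bx bx) => i [].
by exists (exist _ h hlt_p); exact: repr_hpi.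
Qed.

Lemma repr_by_inj xi zeta x : bounded xi -> bounded zeta ->
  repr_by xi x -> repr_by zeta x -> F [set i | xi i = zeta i].
Proof.
move=> bx bz hx hz; apply: filterS2 (filterI hx hz) (bounded_partial_hom bx bz bx).
move=> i [xE zE] [inj _ _ _]; apply: contrapT => /inj; apply.
by rewrite -xE -zE.
Qed.

Lemma repr_byD xi zeta x y : bounded xi -> bounded zeta -> repr_by xi x -> repr_by zeta y ->
  repr_by (fun i => xi i + zeta i) (x + y).
Proof.
move=> bx bz hx hy.
apply: filterS3 (filterI hx hy) (bounded_partial_hom bx bz (boundedD bx bz)) (fp_addE x y).
by move=> i [xE yE] [_ _ /(_ erefl) E _] /= ->; rewrite E xE yE.
Qed.

Lemma repr_byM xi zeta x y : bounded xi -> bounded zeta -> repr_by xi x -> repr_by zeta y ->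
  repr_by (fun i => xi i * zeta i) (x * y).
Proof.
move=> bx bz hx hy.
apply: filterS3 (filterI hx hy) (bounded_partial_hom bx bz (boundedM bx bz)) (fp_mulE x y).
by move=> i [xE yE] [_ _ _ /(_ erefl) E] /= ->; rewrite E xE yE.
Qed.

Lemma repr_by_cst c : repr_by (fun=> c) (e c).
Proof. by apply: filterS filterT. Qed.

Lemma repr_byN xi x : bounded xi -> repr_by xi x -> repr_by (fun i => - xi i) (- x).
Proof.
move=> bx hx; have [y hy] := repr_by_ex (boundedN bx).
have : repr_by (fun=> 0) (x + y).
  by apply: repr_by_ae (repr_byD bx (boundedN bx) hx hy);
    apply: filterS filterT => i _ /=; rewrite subrr.
move=> /(repr_by_uniq (repr_by_cst 0)); rewrite rmorph0 => /esym/eqP.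
by rewrite addrC addr_eq0 => /eqP <-.
Qed.

Lemma repr_byV xi x : bounded xi -> repr_by xi x -> repr_by (fun i => (xi i)^-1) x^-1.
Proof.
move=> bx hx; have [x0|x0] := eqVneq x 0.
  have E := repr_by_inj bx (bounded_cst 0) hx; move: hx.
  rewrite x0 invr0 => hx; apply: repr_by_ae hx; rewrite x0 in E.
  have := E; rewrite -{1}(rmorph0 e) => /(_ (repr_by_cst 0)).
  by apply: filterS => i /= ->; rewrite invr0.
have [y hy] := repr_by_ex (boundedV bx).
suff -> : x^-1 = y by [].
apply: mulr1_eq; rewrite -(rmorph1 e).
apply: (repr_by_uniq (xi := fun=> 1)); last exact: repr_by_cst.
apply: repr_by_ae (repr_byM bx (boundedV bx) hx hy).
have [h|h] := in_ultra_setVsetC [set i | xi i = 0] FU.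
  have : repr_by (fun=> 0) x by apply: repr_by_ae hx.
  move=> /(repr_by_uniq (repr_by_cst 0)); rewrite rmorph0 => x_0.
  by rewrite -x_0 eqxx in x0.
by apply: filterS h => i /= /eqP; exact: mulfV.
Qed.

Definition in_cut : {pred hyperFp hp} :=
  fun x => `[< exists2 xi, bounded xi & repr_by xi x >].

Lemma in_cut_divring : divring_closed in_cut.
Proof.
split=> [|x y|x y]; rewrite /in_mem /=.
- apply/asboolP; exists (fun=> 1); first exact: bounded_cst.
  by rewrite -(rmorph1 e); exact: repr_by_cst.
- move=> /asboolP[xi bx hx] /asboolP[zeta bz hz]; apply/asboolP.
  exists (fun i => xi i - zeta i); first exact: boundedD (boundedN bz).
  exact: (repr_byD bx (boundedN bz) hx (repr_byN bz hz)).
- move=> /asboolP[xi bx hx] /asboolP[zeta bz hz]; apply/asboolP.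
  exists (fun i => xi i / zeta i); first exact: boundedM (boundedV bz).
  exact: (repr_byM bx (boundedV bz) hx (repr_byV bz hz)).
Qed.

Definition cut_subfield : divringClosed (hyperFp hp) :=
  HB.pack in_cut (GRing.isDivringClosed.Build (hyperFp hp) in_cut in_cut_divring).

Local Notation K := (subfield cut_subfield).

Lemma cut_subfieldP x : reflect (exists2 xi, bounded xi & repr_by xi x)
  (x \in cut_subfield).
Proof. exact: asboolP. Qed.

(** The implication makes [class_of] a total function; its values at unbounded sequences are
    unspecified. *)
Lemma class_of_subproof xi : exists x : K, bounded xi -> repr_by xi (val x).
Proof.
have [bx|nb] := pselect (bounded xi); last by exists 0.
have [x hx] := repr_by_ex bx.
have xS : x \in cut_subfield by apply/cut_subfieldP; exists xi.
by exists (exist _ x xS).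
Qed.

Definition class_of xi : K := projT1 (cid (class_of_subproof xi)).

Lemma class_ofP xi : bounded xi -> repr_by xi (val (class_of xi)).
Proof. by rewrite /class_of; case: cid. Qed.

Lemma class_of_uniq xi (x : K) : bounded xi -> repr_by xi (val x) -> class_of xi = x.
Proof. by move=> bx hx; apply: val_inj; exact: repr_by_uniq (class_ofP bx) hx. Qed.

Lemma class_of_surj (x : K) : exists2 xi, bounded xi & class_of xi = x.
Proof.
have /cut_subfieldP[xi bx hx] := valP x.
by exists xi => //; exact: class_of_uniq.
Qed.

Lemma class_of_eq xi zeta : bounded xi -> bounded zeta ->
  class_of xi = class_of zeta <-> F [set i | xi i = zeta i].
Proof.
move=> bx bz; split=> [E|h].
  by apply: (repr_by_inj bx bz (class_ofP bx)); rewrite E; exact: class_ofP.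
by apply: class_of_uniq => //; apply: repr_by_ae (class_ofP bz);
  apply: filterS h => i /= ->.
Qed.

Lemma class_of_nat n : class_of (fun=> n%:R) = n%:R.
Proof.
apply: class_of_uniq; first exact: bounded_cst.
rewrite (rmorph_nat (\val : {rmorphism K -> hyperFp hp})) -(rmorph_nat e).
exact: repr_by_cst.
Qed.

Lemma class_ofN g : bounded g -> class_of (fun i => - g i) = - class_of g.
Proof.
move=> bg; apply: class_of_uniq; first exact: boundedN.
rewrite (rmorphN (\val : {rmorphism K -> hyperFp hp})).
exact: (repr_byN bg (class_ofP bg)).
Qed.

Lemma class_ofD g h : bounded g -> bounded h ->
  class_of (fun i => g i + h i) = class_of g + class_of h.
Proof.
move=> bg bh; apply: class_of_uniq; first exact: boundedD.
rewrite (rmorphD (\val : {rmorphism K -> hyperFp hp})).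
exact: (repr_byD bg bh (class_ofP bg) (class_ofP bh)).
Qed.

Lemma class_ofM g h : bounded g -> bounded h ->
  class_of (fun i => g i * h i) = class_of g * class_of h.
Proof.
move=> bg bh; apply: class_of_uniq; first exact: boundedM.
rewrite subfield_valM; exact: (repr_byM bg bh (class_ofP bg) (class_ofP bh)).
Qed.

Lemma class_of_peval (v : nat -> I -> N) q : (forall j, bounded (v j)) ->
  bounded (fun i => peval (v^~ i) q) /\
  class_of (fun i => peval (v^~ i) q) = peval (class_of \o v) q.
Proof.
move=> bv; elim: q => [j|n|q [bq qE]|q [bq qE] r [br rE]|q [bq qE] r [br rE]] /=.
- by [].
- split; [exact: bounded_cst|exact: class_of_nat].
- by rewrite -qE; split; [exact: boundedN|exact: class_ofN].
- by rewrite -qE -rE; split; [exact: boundedD|exact: class_ofD].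
- by rewrite -qE -rE; split; [exact: boundedM|exact: class_ofM].
Qed.

Lemma update_class_of (v : nat -> I -> N) j xi :
  update (class_of \o v) j (class_of xi) = class_of \o update v j xi.
Proof. by apply/funext => k; rewrite /= /update; case: pselect. Qed.

Lemma update_swap (v : nat -> I -> N) j xi i :
  (update v j xi)^~ i = update (v^~ i) j (xi i).
Proof. by apply/funext => k; rewrite /update; case: pselect. Qed.

Lemma bounded_update (v : nat -> I -> N) j xi : (forall k, bounded (v k)) ->
  bounded xi -> forall k, bounded (update v j xi k).
Proof.
by move=> bv bx k; rewrite /update; case: pselect => ? /=; [exact: bx|exact: bv].
Qed.

(* Existential witnesses stay in the cut by [bounded_skolem]. *)
Lemma cut_los f (v : nat -> I -> N) : (forall j, bounded (v j)) ->
  sat (class_of \o v) f <-> F [set i | sat (v^~ i) f].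
Proof.
elim: f v => [q r|g IH|g IHg h IHh|j g IH] v bv /=.
- have [bq <-] := class_of_peval q bv; have [br <-] := class_of_peval r bv.
  exact: class_of_eq.
- rewrite (IH v bv); split=> [nF|h1 h2].
    by have [/nF|] := in_ultra_setVsetC [set i | sat (v^~ i) g] FU.
  by have [i [? ?]] := filter_ex (filterI h1 h2).
- rewrite (IHg v bv) (IHh v bv); split=> [[h1 h2]|h12].
    by apply: filterS2 h1 h2.
  by split; apply: filterS h12 => i [].
- split=> [[x]|h].
    have [xi bx <-] := class_of_surj x; rewrite update_class_of.
    move=> /(IH _ (bounded_update j bv bx)); apply: filterS => i /=.
    by rewrite update_swap; exists (xi i).
  have [xi bx h'] := bounded_skolem bv h; exists (class_of xi).
  rewrite update_class_of; apply/(IH _ (bounded_update j bv bx)).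
  by apply: filterS h' => i /=; rewrite update_swap.
Qed.

Lemma cut_elementary f : (forall v : nat -> N, sat v f) -> forall v : nat -> K, sat v f.
Proof.
move=> Nf v.
have /choice[u uP] : forall j, exists xi, bounded xi /\ class_of xi = v j.
  by move=> j; have [xi] := class_of_surj (v j); exists xi.
have -> : v = class_of \o u by apply/funext => j; have [_ <-] := uP j.
apply/cut_los => [j|]; first by have [] := uP j.
by apply: filterS filterT => i _; exact: Nf.
Qed.

(** The countably many translated formulas are numbered, and [E n] asks for an element of code at
    most [M n] satisfying those up to number [n]. Finite satisfiability gives each [E n] almost
    everywhere, and overspill gives a sequence good up to an infinite [nu]. Its codes are below
    [M nu], hence below every [M k], so it stays in the cut. *)
Lemma cut_saturated : countably_incomplete F -> aleph1_saturated K.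
Proof.
move=> ci A Phi /pcard_injP[idx idxI] PhiA fin.
have [->|/set0P[f0 Phif0]] := eqVneq Phi set0; first by exists 0.
have [c cI] := fo_code.
have [par parP] : exists par : nat -> K, forall a, A a -> par (idx a) = a.
  have [|par parP] := @choice_in nat K (idx @` A) (fun j a => A a /\ idx a = j) 0.
    by move=> _ [a Aa <-]; exists a.
  exists par => a Aa; have [|Ap pE] := parP (idx a); first by exists a.
  by apply: idxI pE; rewrite inE.
(* Odd variables carry representatives of the parameters; the even ones start at [0]. *)
have /choice[u uP] : forall j, exists xi, bounded xi /\
    class_of xi = if odd j then par j./2 else 0.
  by move=> j; have [xi] := class_of_surj (if odd j then par j./2 else 0); exists xi.
have bu j : bounded (u j) by have [] := uP j.
have int xi : bounded xi ->
    interprets A idx (class_of \o update u 0%N xi) [:: class_of xi].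
  move=> bx; split=> [[|i]|a Aa] /=; first by rewrite update_eq.
    rewrite update_neq // nth_nil; have [_ ->] := uP i.+1.*2.
    by rewrite odd_double.
  rewrite update_neq //; have [_ ->] := uP (idx a).*2.+1.
  by rewrite /= odd_double /= uphalf_double parP.
have los xi f : bounded xi -> Phi f -> GRing.holds [:: class_of xi] f <->
    F [set i | sat (update (u^~ i) 0%N (xi i)) (trans idx f)].
  move=> bx Pf; rewrite -(transP (int _ bx) (PhiA _ Pf)) cut_los.
    by split; apply: filterS => i /=; rewrite update_swap.
  exact: bounded_update.
(* An enumeration of [Phi] up to equal translations, with [f0] at the numbers that code none. *)
have /choice[g gP] : forall l, exists f, Phi f /\
    ((exists2 h, Phi h & c (trans idx h) = l) -> c (trans idx f) = l).
  move=> l; have [[h Ph hl]|nh] := pselect (exists2 h, Phi h & c (trans idx h) = l).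
    by exists h.
  by exists f0.
have Pg l : Phi (g l) by have [] := gP l.
pose E n : set I := [set i | exists r, (code r <= M n i)%N /\
  forall l, (l <= n)%N -> sat (update (u^~ i) 0%N r) (trans idx (g l))].
have FE n : F (E n).
  have [|_ [l _ <-] //|x xP] := fin (g @` `I_n.+1); first exact/finite_image/finite_II.
  have [xi bx xE] := class_of_surj x.
  have Fl : F [set i | forall l, (l <= n)%N ->
      sat (update (u^~ i) 0%N (xi i)) (trans idx (g l))].
    by apply: filter_forall_le => l ln; apply/los => //; rewrite xE; apply: xP; exists l.
  by apply: filterS2 Fl (bx n) => i h b; exists (xi i).
have [nu [nuinf nuE]] := overspill ci FE.
have /choice[xi xiP] : forall i, exists r, E (nu i) i -> (code r <= M (nu i) i)%N /\
    forall l, (l <= nu i)%N -> sat (update (u^~ i) 0%N r) (trans idx (g l)).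
  by move=> i; have [[r h]|nE] := pselect (E (nu i) i); [exists r|exists 0].
have bx : bounded xi.
  move=> k; apply: filterS2 nuE (nuinf k) => i /(_ _ (leqnn _))/xiP[h _] knu.
  exact: leq_trans h (M_le _ knu).
exists (class_of xi) => f Pf; apply/los => //.
have fl : trans idx f = trans idx (g (c (trans idx f))).
  by apply: cI; have [_ h] := gP (c (trans idx f)); rewrite h //; exists f.
rewrite fl; apply: filterS2 nuE (nuinf (c (trans idx f))) => i.
by move=> /(_ _ (leqnn _))/xiP[_ h]; exact: h.
Qed.

(** A set is sent to the class of the numerals coding its initial segments of infinite length [mu].
    Distinct sets differ at a standard place, which is below [mu] almost everywhere; and [mu] is so
    small that the codes of all bit strings of this length are below [nu], hence in the cut. *)
Lemma cut_continuum (nu : I -> nat) : countably_incomplete F ->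
  (forall n, (n%:R == 0 :> N) = (n == 0)%N) ->
  infinite_index F nu -> (forall k i, (nu i <= M k i)%N) ->
  exists f : set nat -> K, injective f.
Proof.
move=> ci ch0 nuinf nuM.
pose enc (s : seq bool) : N := (pickle s)%:R.
have encI : injective enc by move=> s t /(natr_inj_char0 ch0) /(pcan_inj pickleK).
pose b n := (\max_(t : n.-tuple bool) code (enc t))%N.
have [mu [muinf mub]] := infinite_index_le b ci nuinf.
pose pre (X : set nat) i := mkseq (fun m => `[< X m >]) (mu i).
have bX X : bounded (fun i => enc (pre X i)).
  move=> k; apply: filterS mub => i /= h; apply: leq_trans (leq_trans h (nuM k i)).
  have sz : size (pre X i) == mu i by rewrite size_mkseq.
  exact: (@leq_bigmax _ (fun t : (mu i).-tuple bool => code (enc t)) (Tuple sz)).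
exists (fun X => class_of (fun i => enc (pre X i))) => X Y /(class_of_eq (bX X) (bX Y)) E.
apply/funext => m; apply/propext.
have [i [/encI XY /= mi]] := filter_ex (filterI E (muinf m.+1)).
have := congr1 (fun s => nth false s m) XY; rewrite !nth_mkseq // => XYm.
by split=> h; apply/asboolP; [rewrite -XYm|rewrite XYm]; exact/asboolP.
Qed.

(** The internal sets are the images of the intervals up to [M k]. A point common to them has a
    preimage for each [k], and injectivity of the coordinates below [M 0] identifies all of these
    with the first, which therefore lies in the cut. *)
Lemma cut_delta_set : delta_set (carrier cut_subfield).
Proof.
pose B k i : set nat := [set c | exists2 r, (code r <= M k i)%N & c = coord i r].
exists (fun k => [set y | exists2 g, F [set i | B k i (g i)] & y = \pi_(@hypernat I F FU) g]).
split=> [k|].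
  by rewrite -(@ultraval_inr I F FU 0 (B k)); exact: internal_ultraval.
apply/seteqP; split=> [_ [x /cut_subfieldP[xi bx hx] <-] k _ /=|y yB].
  exists (fun i => coord i (xi i)).
    by apply: filterS (bx k) => i /= h; exists (xi i).
  by rewrite -[LHS]reprK; exact/hpiE.
have [xi xiP] : exists xi : nat -> I -> N, forall k,
    F [set i | (code (xi k i) <= M k i)%N /\ repr y i = coord i (xi k i)].
  suff /choice[xi xiP] : forall k, exists xi : I -> N,
      F [set i | (code (xi i) <= M k i)%N /\ repr y i = coord i (xi i)] by exists xi.
  move=> k; have [g Fg yg] := yB k Logic.I.
  have /choice[xi xiP] : forall i, exists r, B k i (g i) ->
      (code r <= M k i)%N /\ g i = coord i r.
    by move=> i; have [[r rM gr]|nB] := pselect (B k i (g i)); [exists r|exists 0].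
  exists xi; apply: filterS2 Fg (repr_hpi g) => i /= /xiP[? gi] yE.
  by rewrite yg yE.
have eq0 k : F [set i | xi 0%N i = xi k i].
  apply: filterS3 (xiP 0%N) (xiP k) Mhom => i [c0 y0] [ck yk] hom.
  have [inj _ _ _] := hom (xi 0%N i) (xi k i) (xi 0%N i) c0
    (leq_trans ck (M_le i (leq0n k))) c0.
  by apply: contrapT => /inj; apply; rewrite -y0 -yk.
have bx : bounded (xi 0%N).
  by move=> k; apply: filterS2 (eq0 k) (xiP k) => i /= -> [].
have [x hx] := repr_by_ex bx.
exists x; first by apply/cut_subfieldP; exists (xi 0%N).
rewrite -[LHS]reprK -[RHS]reprK; apply/hpiE.
by apply: filterS2 hx (xiP 0%N) => i /= -> [_ ->].
Qed.

(** The internal function sends the image of an element of code at most [M 0] to this code. It is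
    single-valued because the coordinates are injective below [M 0], and the carrier is its preimage
    of the cut of all hypernaturals below every [M k]. *)
Lemma cut_almost_internal : almost_internal (carrier cut_subfield).
Proof.
pose G i : set (superstr nat 2) := [set z | exists2 r, (code r <= M 0 i)%N &
  z = vpair (coord i r : superstr nat 0) (code r : superstr nat 0)].
pose f := @ultraval I F FU 3 (fun i => inr (G i)).
pose C : set (@hypernat I F FU) := [set c | forall k, F [set i | (repr c i <= M k i)%N]].
have fE : f = inr [set y | exists2 g, F [set i | G i (g i)] & y = ultraval (F := F) g].
  exact: ultraval_inr.
have fP z : vmem z f <-> exists2 xi : I -> N, F [set i | (code (xi i) <= M 0 i)%N] &
    z = vpair (\pi_(@hypernat I F FU) (fun i => coord i (xi i)) : superstr (hypernat F) 0)
          (\pi_(@hypernat I F FU) (fun i => code (xi i)) : superstr (hypernat F) 0).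
  rewrite fE; split=> [[g Fg ->]|[xi xM ->]].
    have /choice[xi xiP] : forall i, exists r, G i (g i) -> (code r <= M 0 i)%N /\
        g i = vpair (coord i r : superstr nat 0) (code r : superstr nat 0).
      by move=> i; have [[r rM gr]|nB] := pselect (G i (g i)); [exists r|exists 0].
    exists xi; first by apply: filterS Fg => i /xiP[].
    rewrite -[RHS](@ultraval_vpair I F FU 0); apply: ultraval_ae.
    by apply: filterS Fg => i /xiP[].
  exists (fun i => vpair (coord i (xi i) : superstr nat 0) (code (xi i) : superstr nat 0)).
    by apply: filterS xM => i /= h; exists (xi i).
  by rewrite (@ultraval_vpair I F FU 0).
exists 0%N, f, C; split.
- exact: internal_ultraval.
- split; first by rewrite fE; eexists.
    by move=> z /fP[xi _ ->]; eexists; eexists; reflexivity.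
  move=> a c c' /fP[xi xM /vpair_inj[/= aE cE]] /fP[zeta zM /vpair_inj[/= aE' cE']].
  rewrite cE cE'; apply/hpiE.
  have /hpiE cc : \pi_(@hypernat I F FU) (fun i => coord i (xi i)) =
      \pi_(@hypernat I F FU) (fun i => coord i (zeta i)) by rewrite -aE -aE'.
  apply: filterS2 cc (filterI (filterI xM zM) Mhom) => i /= cci [[xm zm] hom].
  have [inj _ _ _] := hom _ _ _ xm zm xm.
  by have -> : xi i = zeta i by apply: contrapT => /inj; apply.
- move=> x y /asboolP xy Cy k; apply: filterS2 xy (Cy k) => i /=; exact: leq_trans.
have imid (A : set (hypernat F)) : @vatom (hypernat F) 0 @` A = A.
  by apply/seteqP; split=> [_ [x Ax <-]//|x Ax]; exists x.
rewrite imid; apply/seteqP; split.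
  move=> _ [x /cut_subfieldP[xi bx hx] <-].
  exists (\pi_(@hypernat I F FU) (fun i => code (xi i))).
    by move=> k; apply: filterS2 (bx k) (repr_hpi (fun i => code (xi i))) => i /= + ->.
  apply/fP; exists xi; first exact: bx.
  congr (vpair _ _); rewrite -[LHS]reprK; exact/hpiE.
move=> a [c Cc /fP[xi xM /vpair_inj[/= -> cE]]].
have bx : bounded xi.
  move=> k; apply: filterS2 (Cc k) (repr_hpi (fun i => code (xi i))) => i /=.
  by rewrite cE => + <-.
have [x hx] := repr_by_ex bx.
exists x; first by apply/cut_subfieldP; exists xi.
rewrite -[LHS]reprK; exact/hpiE.
Qed.

End PartialEmbedding.

(* The subfield is the image of the elements of the ultrapower of [N] whose
   codes lie in a small cut closed under all Skolem bounds. *)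
Lemma elementary_delta_subfield (I : Type) (F : set_system I) (FU : UltraFilter F)
    (p : hypernat F) (hp : hyperprime p) (N : fieldType) (code : N -> nat) :
  countably_incomplete F -> injective code ->
  (forall n, (n%:R == 0 :> N) = (n == 0)%N) ->
  {rmorphism N -> hyperFp hp} ->
  exists S : divringClosed (hyperFp hp),
    [/\ almost_internal (carrier S), delta_set (carrier S),
      aleph1_saturated (subfield S),
      exists f : set nat -> subfield S, injective f &
      forall f, (forall v : nat -> N, sat v f) -> forall v : nat -> subfield S, sat v f].
Proof.
move=> ci codeI ch0 e; have [w wP] := skolem_bound codeI.
have [d [dinf dhom]] := overspill ci (partial_hom_ae e codeI).
have [M [nu [Mdec Md nuinf nuM Mw]]] := closed_cut w ci dinf.
have Mhom : F [set i | partial_hom code e (M 0 i) i].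
  by apply: filterS2 Md dhom => i /= Mdi; apply.
have Minf k : infinite_index F (M k).
  by move=> n; apply: filterS (nuinf n) => i /= h; exact: leq_trans h (nuM k i).
exists (@cut_subfield _ _ _ _ _ _ _ e _ _ Mhom Mw Minf wP); split.
- exact: cut_almost_internal.
- exact: cut_delta_set.
- exact: cut_saturated.
- exact: cut_continuum nuinf nuM.
- exact: cut_elementary.
Qed.

(** * Real closed and algebraically closed fields *)

Definition is_square (K : nzRingType) (x : K) : Prop := exists z, x = z * z.

(** Real closedness in the language of rings, the squares being the nonnegative elements:
    comparability, additivity, antisymmetry and the intermediate value property. For polynomials of
    bounded degree each clause is first-order, so it passes to the subfield. *)
Definition real_closed_by_squares (K : fieldType) : Prop :=
  [/\ forall x : K, is_square x \/ is_square (- x),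
    forall x y : K, is_square x -> is_square y -> is_square (x + y),
    forall x : K, is_square x -> is_square (- x) -> x = 0 &
    forall (p : {poly K}) a b, is_square (b - a) -> is_square (- p.[a]) ->
      is_square p.[b] -> exists x, [/\ is_square (x - a), is_square (b - x) & root p x]].

Section SquareOrder.
Variable K : fieldType.
Hypothesis rcK : real_closed_by_squares K.

(** The alias carries the proof from which its order is built. *)
Definition square_ordered of real_closed_by_squares K : Type := K.
Local Notation L := (square_ordered rcK).

HB.instance Definition _ := GRing.Field.on L.

Definition sle (x y : L) : bool := `[< is_square (y - x : K) >].
Definition snorm (x : L) : L := if sle 0 x then x else - x.

Lemma sleP x y : reflect (is_square (y - x : K)) (sle x y).
Proof. exact: asboolP. Qed.

Lemma sle0 x : sle 0 x <-> is_square (x : K).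
Proof. by rewrite -[X in is_square X]subr0; split=> /sleP. Qed.

Lemma slex0 x : sle x 0 <-> is_square (- x : K).
Proof. by rewrite -[X in is_square X]sub0r; split=> /sleP. Qed.

Lemma sle0_add x y : sle 0 x -> sle 0 y -> sle 0 (x + y).
Proof. by have [_ h _ _] := rcK; move=> /sle0 ? /sle0 ?; apply/sle0; exact: h. Qed.

Lemma sle0_mul x y : sle 0 x -> sle 0 y -> sle 0 (x * y).
Proof.
move=> /sle0[z ->] /sle0[w ->]; apply/sle0.
by exists (z * w : K); rewrite mulrACA.
Qed.

Lemma sle0_anti x : sle 0 x -> sle x 0 -> x = 0.
Proof. by have [_ _ h _] := rcK; move=> /sle0 ? /slex0 ?; exact: h. Qed.

Lemma ssub_ge0 x y : sle 0 (y - x) = sle x y.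
Proof. by rewrite /sle subr0. Qed.

Lemma sle0_total x : sle 0 x || sle x 0.
Proof.
have [h _ _ _] := rcK; have [xs|xs] := h x.
  by have -> : sle 0 x by apply/sle0.
by have -> : sle x 0 by [apply/slex0]; rewrite orbT.
Qed.

Lemma sge0_norm x : sle 0 x -> snorm x = x.
Proof. by rewrite /snorm => ->. Qed.

Lemma snormN x : snorm (- x) = snorm x.
Proof.
have E y : sle 0 (- y) = sle y 0 by rewrite -[- y]sub0r ssub_ge0.
rewrite /snorm E; case: ifP => x0; case: ifP => x0'; rewrite ?opprK //.
  by rewrite (sle0_anti x0' x0) oppr0.
by have := sle0_total x; rewrite x0 x0'.
Qed.

HB.instance Definition _ := Num.IntegralDomain_isLeReal.Build L
  sle0_add sle0_mul sle0_anti ssub_ge0 sle0_total snormN sge0_norm (fun x y => erefl).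

Lemma square_ordered_ivt : Num.real_closed_axiom L.
Proof.
have [_ _ _ ivt] := rcK.
move=> p a b /sleP ab /andP[/slex0 pa /sle0 pb].
have [x [xa xb px]] := ivt p a b ab pa pb.
by exists x => //; apply/andP; split; apply/sleP.
Qed.

HB.instance Definition _ := Num.RealField_isClosed.Build L square_ordered_ivt.

Lemma real_closed_of_squares : real_closed K.
Proof.
exists L, (idfun : {rmorphism K -> L}).
by exists id.
Qed.

End SquareOrder.

(** * The real algebraic numbers *)

Section RealAlgebraicNumbers.
Variable R : realType.
Local Notation RA := (subfield (@real_alg R)).
Local Notation toR := (\val : {rmorphism RA -> R}).

Lemma real_alg_root (q : {poly RA}) y : q != 0 -> root (map_poly toR q) y ->
  y \in @real_alg R.
Proof.
move=> q0 qy; apply/asboolP/integral_algebraic.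
apply: (integral_root _ qy); first by rewrite map_poly_eq0.
move=> c /(nthP 0)[i _ <-]; rewrite coef_map; apply/integral_algebraic.
by have /asboolP := valP q`_i.
Qed.

Lemma real_alg_square (x : RA) : is_square x <-> 0 <= toR x.
Proof.
split=> [[z ->]|x0]; first by rewrite rmorphM -expr2 sqr_ge0.
have root_sqrt (F : fieldType) (f : {rmorphism F -> R}) c :
    0 <= f c -> root (map_poly f ('X^2 - c%:P)) (Num.sqrt (f c)).
  move=> c0; rewrite rmorphB /= map_polyXn map_polyC /root !hornerE.
  by rewrite sqr_sqrtr // subrr.
have yA : Num.sqrt (toR x) \in @real_alg R.
  apply: (real_alg_root (q := 'X^2 - x%:P)).
    by rewrite -size_poly_eq0 size_XnsubC.
  exact: root_sqrt.
exists (exist (fun z => z \in @real_alg R) _ yA : RA); apply: (fmorph_inj toR).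
by rewrite rmorphM -[RHS]expr2 sqr_sqrtr.
Qed.

Lemma real_alg_closed_by_squares : real_closed_by_squares RA.
Proof.
split=> [x|x y|x|q a b].
- rewrite !real_alg_square rmorphN oppr_ge0.
  by case/orP: (le_total 0 (toR x)) => ?; [left|right].
- by rewrite !real_alg_square rmorphD; exact: addr_ge0.
- rewrite !real_alg_square rmorphN oppr_ge0 => h1 h2; apply: (fmorph_inj toR).
  by rewrite rmorph0; apply/eqP; rewrite eq_le h1 h2.
rewrite !real_alg_square rmorphB rmorphN oppr_ge0 subr_ge0 => ab qa qb.
have [->|q0] := eqVneq q 0.
  exists a; split; rewrite ?root0 //; apply/real_alg_square.
    by rewrite subrr rmorph0.
  by rewrite rmorphB subr_ge0.
have [|x /andP[ax xb] qx] := poly_ivt (p := map_poly toR q) ab.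
  by rewrite !horner_map qa.
have xA := real_alg_root q0 qx; exists (exist (fun z => z \in @real_alg R) x xA : RA).
split; [apply/real_alg_square|apply/real_alg_square|].
- by rewrite rmorphB subr_ge0.
- by rewrite rmorphB subr_ge0.
- by rewrite -(fmorph_root toR).
Qed.

Lemma real_alg_countable : exists code : RA -> nat, injective code.
Proof.
have /choice[q qP] : forall x : RA, exists q : {poly rat},
    q != 0 /\ root (map_poly (@ratr R) q) (toR x).
  by move=> x; have /asboolP[q q0 qx] := valP x; exists q.
have /choice[rs rsP] : forall q : {poly rat}, exists rs : seq R, q != 0 ->
    forall y, root (map_poly (@ratr R) q) y -> y \in rs.
  move=> s; have [->|s0] := eqVneq s 0; first by exists [::].
  have [|rs ?] := @roots_seq R (map_poly ratr s); last by exists rs.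
  by rewrite map_poly_eq0.
exists (fun x => pickle (q x, index (toR x) (rs (q x)))) => x y.
move=> /(pcan_inj pickleK)[qE iE]; apply: (fmorph_inj toR).
have [qx0 /(rsP _ qx0) xin] := qP x; have [qy0 /(rsP _ qy0) yin] := qP y.
by rewrite -(nth_index 0 xin) -(nth_index 0 yin) iE qE.
Qed.

End RealAlgebraicNumbers.

(** * Transfer of closedness to the subfield *)

Section ElementaryTransfer.
Variables (N K : fieldType).
Hypothesis NK : forall f, (forall v : nat -> N, sat v f) -> forall v : nat -> K, sat v f.

Let ppow (t : pexp nat) n := iter n (PMul t) (PNat 1).

(** The generic polynomial of degree below [n] in [t]; its coefficients are the variables from [o]
    on. *)
Fixpoint ppoly o n (t : pexp nat) : pexp nat :=
  if n is m.+1 then PAdd (ppoly o m t) (PMul (PVar (o + m)) (ppow t m)) else PNat 0.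

Lemma peval_ppoly (F : fieldType) (v : nat -> F) o n t :
  peval v (ppoly o n t) = \sum_(k < n) v (o + k)%N * peval v t ^+ k.
Proof.
elim: n => [|n IH] /=; first by rewrite big_ord0.
rewrite big_ord_recr IH /=; congr (_ + _ * _).
by elim: n {IH} => //= n ->; rewrite exprS.
Qed.

Lemma closed_field_transfer : GRing.closed_field_axiom N -> GRing.closed_field_axiom K.
Proof.
move=> cN n P n0.
pose f := FEx 0 (FEq (ppow (PVar 0) n) (ppoly 1 n (PVar 0))).
have fP (F : fieldType) (v : nat -> F) : sat v f <->
    exists x, x ^+ n = \sum_(k < n) v k.+1 * x ^+ k.
  have E x : peval (update v 0%N x) (ppow (PVar 0) n) = x ^+ n.
    by elim: n {n0 f} => //= n ->; rewrite update_eq exprS.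
  have E' x : peval (update v 0%N x) (ppoly 1 n (PVar 0)) = \sum_(k < n) v k.+1 * x ^+ k.
    rewrite peval_ppoly; apply: eq_bigr => k _ /=.
    by rewrite update_eq update_neq.
  split=> -[x h]; exists x; first by rewrite -[LHS]E -[RHS]E'; exact: h.
  have : peval (update v 0%N x) (ppow (PVar 0) n) = peval (update v 0%N x) (ppoly 1 n (PVar 0)).
    by rewrite E E'.
  by [].
have /fP[x xP] := NK (fun v => (proj2 (fP N v)) (cN n (fun k => v k.+1) n0))
  (fun k => if k is k'.+1 then P k' else 0).
by exists x.
Qed.

(** Variable 5 is reserved for the square root, hence the condition that [t] use only variables
    below it. *)
Let sq t := FEx 5 (FEq t (PMul (PVar 5) (PVar 5))).

Let sat_sq (F : fieldType) (v : nat -> F) t : (pbound t <= 5)%N ->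
  sat v (sq t) <-> is_square (peval v t).
Proof.
move=> t5; have E x : peval (update v 5 x) t = peval v t.
  apply: peval_ext => j /pvars_bound jt; apply: update_neq => j5.
  by move: (leq_trans jt t5); rewrite j5.
by split=> -[x h]; exists x; move: h; rewrite /= update_eq E.
Qed.

(** Each clause becomes a formula in which the hypotheses that something is a square are replaced by
    equations with a free variable as the root. *)
Lemma real_closed_by_squares_transfer :
  real_closed_by_squares N -> real_closed_by_squares K.
Proof.
move=> [N1 N2 N3 N4].
pose v2 (F : fieldType) (x y : F) k : F := if k is 0%N then x else y.
split.
- move=> x.
  pose f := FNot (FAnd (FNot (sq (PVar 0))) (FNot (sq (POpp (PVar 0))))).
  have fP (F : fieldType) (v : nat -> F) :
      sat v f <-> is_square (v 0%N) \/ is_square (- v 0%N).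
    have E1 := sat_sq v (t := PVar 0) isT; have E2 := sat_sq v (t := POpp (PVar 0)) isT.
    have -> : sat v f = ~ (~ sat v (sq (PVar 0)) /\ ~ sat v (sq (POpp (PVar 0)))) by [].
    rewrite E1 E2 /=; have := pselect (is_square (v 0%N)); have := pselect (is_square (- v 0%N)); tauto.
  by apply/(fP K (fun=> x)); apply: NK => v; apply/fP; exact: N1.
- move=> _ _ [z ->] [w ->].
  pose f := sq (PAdd (PMul (PVar 0) (PVar 0)) (PMul (PVar 1) (PVar 1))).
  have fP (F : fieldType) (v : nat -> F) :
      sat v f <-> is_square (v 0%N * v 0%N + v 1%N * v 1%N).
    exact: sat_sq.
  apply/(fP K (v2 K z w)); apply: NK => v; apply/fP; apply: N2.
    by exists (v 0%N).
  by exists (v 1%N).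
- move=> _ [z ->] [w wE].
  pose f := FNot (FAnd (FEq (POpp (PMul (PVar 0) (PVar 0))) (PMul (PVar 1) (PVar 1)))
    (FNot (FEq (PMul (PVar 0) (PVar 0)) (PNat 0)))).
  have fP (F : fieldType) (v : nat -> F) :
      sat v f <-> (- (v 0%N * v 0%N) = v 1%N * v 1%N -> v 0%N * v 0%N = 0).
    by rewrite /=; have := pselect (v 0%N * v 0%N = 0); tauto.
  apply: (proj1 (fP K (v2 K z w))) => //; apply: NK => v; apply/fP => E.
  by apply: N3; [exists (v 0%N)|exists (v 1%N)].
move=> q a b [c cE] [d dE] [g gE]; pose n := size q.
pose pb : pexp nat := PAdd (PVar 0%N) (PMul (PVar 1%N) (PVar 1%N)).
(* Variable 0 is [a]; 1, 2 and 3 are square roots of [b - a], of minus the value at [a] and of the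
   value at [b]; 4 is the zero sought, 5 is used by [sq], and the coefficients start at 6. *)
pose f := FNot (FAnd (FEq (POpp (ppoly 6 n (PVar 0))) (PMul (PVar 2) (PVar 2)))
  (FAnd (FEq (ppoly 6 n pb) (PMul (PVar 3) (PVar 3)))
  (FNot (FEx 4 (FAnd (sq (PAdd (PVar 4) (POpp (PVar 0))))
     (FAnd (sq (PAdd pb (POpp (PVar 4)))) (FEq (ppoly 6 n (PVar 4)) (PNat 0)))))))).
pose vpoly (F : fieldType) (v : nat -> F) x := \sum_(k < n) v (6 + k)%N * x ^+ k.
have fP (F : fieldType) (v : nat -> F) : sat v f <->
    (- vpoly F v (v 0%N) = v 2 * v 2 ->
     vpoly F v (v 0%N + v 1%N * v 1%N) = v 3 * v 3 ->
     exists x, [/\ is_square (x - v 0%N), is_square (v 0%N + v 1%N * v 1%N - x) &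
       vpoly F v x = 0]).
  have E x : sat (update v 4 x) (FAnd (sq (PAdd (PVar 4) (POpp (PVar 0))))
     (FAnd (sq (PAdd pb (POpp (PVar 4)))) (FEq (ppoly 6 n (PVar 4)) (PNat 0)))) <->
      [/\ is_square (x - v 0%N), is_square (v 0%N + v 1%N * v 1%N - x) &
       vpoly F v x = 0].
    have E1 : sat (update v 4 x) (sq (PAdd (PVar 4) (POpp (PVar 0)))) <->
        is_square (x - v 0%N) by rewrite sat_sq //= update_eq update_neq.
    have E2 : sat (update v 4 x) (sq (PAdd pb (POpp (PVar 4)))) <->
        is_square (v 0%N + v 1%N * v 1%N - x).
      by rewrite sat_sq //= update_eq !update_neq.
    have E3 : peval (update v 4 x) (ppoly 6 n (PVar 4)) = vpoly F v x.
      rewrite peval_ppoly; apply: eq_bigr => k _ /=.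
      by rewrite update_eq update_neq.
    by split=> [[/E1 ? [/E2 ? h]]|[/E1 ? /E2 ? h]]; split=> //;
      [rewrite -E3; exact: h|split=> //; rewrite -E3 in h; exact: h].
  have PE t : peval v (ppoly 6 n t) = vpoly F v (peval v t) by exact: peval_ppoly.
  split=> [h A B|h [A [B nE]]].
    apply: contrapT => nE; apply: h; split; first by rewrite /= PE.
    split; first by rewrite /= PE.
    by move=> [x /E h]; apply: nE; exists x.
  rewrite /= !PE /= in A B; have [x /E hx] := h A B.
  by apply: nE; exists x.
pose v (k : nat) : K :=
  match k with 0%N => a | 1%N => c | 2%N => d | 3%N => g | _ => q`_(k - 6)%N end.
have vE x : vpoly K v x = q.[x].
  rewrite horner_coef; apply: eq_bigr => k _.
  by have -> : v (6 + k)%N = q`_(6 + k - 6)%N by []; rewrite addKn.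
have bE : b = v 0%N + v 1%N * v 1%N by rewrite /= -cE addrC subrK.
have [|||x [xa xb]] := proj1 (fP K v).
- apply: NK => u; apply/fP => A B.
  pose r : {poly N} := \poly_(k < n) u (6 + k)%N.
  have rE x : r.[x] = vpoly N u x.
    rewrite /r poly_def horner_sum; apply: eq_bigr => k _.
    by rewrite hornerZ hornerXn.
  have [|||x [xa xb rx]] := N4 r (u 0%N) (u 0%N + u 1%N * u 1%N).
  + by exists (u 1%N); rewrite addrC addKr.
  + by exists (u 2%N); rewrite rE.
  + by exists (u 3%N); rewrite rE.
  by exists x; split=> //; rewrite -rE; exact/rootP.
- by rewrite vE.
- by rewrite vE -bE.
by rewrite vE => qx; exists x; split=> //; [rewrite bE|exact/rootP].
Qed.

End ElementaryTransfer.

(** * Adjoining a square root of -1 *)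

Section ComplexEmbedding.
Variables (L : rcfType) (H : fieldType) (e : {rmorphism L -> H}) (j : H).
Hypothesis j2 : j ^+ 2 = - 1.

Definition complex_map of j ^+ 2 = -1 : L[i]%C -> H :=
  fun z => e (complex.Re z) + j * e (complex.Im z).

Lemma complex_map_zmod_morphism : zmod_morphism (complex_map j2).
Proof.
by move=> [a b] [c d]; rewrite /complex_map /= !rmorphB mulrBr opprD addrACA.
Qed.

Lemma complex_map_monoid_morphism : monoid_morphism (complex_map j2).
Proof.
split=> [|[a b] [c d]]; rewrite /complex_map /=.
  by rewrite rmorph1 rmorph0 mulr0 addr0.
rewrite rmorphB rmorphD !rmorphM; move: (e a) (e b) (e c) (e d) => A B C D.
have -> : (A + j * B) * (C + j * D) = A * C + j ^+ 2 * (B * D) + j * (A * D + B * C).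
  by rewrite expr2; ring.
by rewrite j2; ring.
Qed.

HB.instance Definition _ :=
  GRing.isZmodMorphism.Build L[i]%C H (complex_map j2) complex_map_zmod_morphism.
HB.instance Definition _ :=
  GRing.isMonoidMorphism.Build L[i]%C H (complex_map j2) complex_map_monoid_morphism.

End ComplexEmbedding.

Theorem theorem0p7 (I : Type) (F : set_system I) (FU : UltraFilter F)
    (Fincomplete : countably_incomplete F) (R : realType)
    (p : hypernat F) (hp : hyperprime p)
    (hnonstd : forall n : nat, p <> std F n)
    (hemb : inhabited {rmorphism subfield (@real_alg R) -> hyperFp hp}) :
  ((exists i : hyperFp hp, i ^+ 2 = - 1) ->
     (exists S, closed_delta_subfield (hp := hp) S) /\
     (forall S, closed_delta_subfield (hp := hp) S ->
        power_continuum #<= @field_embeddings R (subfield S))) /\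
  (~ (exists i : hyperFp hp, i ^+ 2 = - 1) ->
     (exists S, real_delta_subfield (hp := hp) S) /\
     (forall S, real_delta_subfield (hp := hp) S ->
        power_continuum #<= @field_embeddings R (subfield S))).
Proof.
have [e] := hemb; pose RA := subfield (@real_alg R).
have chRA n : (n%:R == 0 :> RA) = (n == 0)%N.
  by rewrite -(fmorph_eq0 (\val : {rmorphism RA -> R})) rmorph_nat pnatr_eq0.
have [code codeI] := real_alg_countable R.
have sqRA := @real_alg_closed_by_squares R.
split=> [[j j2]|_]; split.
(* The ordered copy [L] of the real algebraic numbers allows [L[i]] to be formed; it is countable
   and algebraically closed, and it embeds by sending the imaginary unit to [j]. *)
- have [L [f [g fK gK]]] := real_closed_of_squares sqRA.
  have gB : zmod_morphism g by exact: (can2_zmod_morphism fK gK).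
  have gM : monoid_morphism g by exact: (can2_monoid_morphism fK gK).
  pose h : {rmorphism L -> RA} := HB.pack g
    (GRing.isZmodMorphism.Build L RA g gB) (GRing.isMonoidMorphism.Build L RA g gM).
  pose c (z : L[i]%C) : nat := pickle (code (g (complex.Re z)), code (g (complex.Im z))).
  have cI : injective c.
    move=> [a b] [a' b'] /(pcan_inj pickleK)[/= /codeI/(can_inj gK) -> ].
    by move=> /codeI/(can_inj gK) ->.
  have chC n : (n%:R == 0 :> L[i]%C) = (n == 0)%N by exact: pnatr_eq0.
  pose eh : {rmorphism L -> hyperFp hp} := [the {rmorphism _ -> _} of e \o h].
  have [S [Sint Sdelta _ [k kI] Sel]] := elementary_delta_subfield Fincomplete cI chC
    [the {rmorphism L[i]%C -> hyperFp hp} of complex_map eh j2].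
  exists S; split=> //.
  + exact: closed_field_transfer Sel (@complex_acf_axiom L).
  + by apply: (injective_card_le (f := k)) => // x y _ _; exact: kI.
- move=> S [_ _ Scl Sc]; apply: closed_field_embeddings => // n.
  rewrite -(fmorph_eq0 (\val : {rmorphism subfield S -> hyperFp hp})) rmorph_nat.
  by rewrite -(rmorph_nat e) fmorph_eq0.
- have [S [Sint Sdelta Ssat _ Sel]] := elementary_delta_subfield Fincomplete codeI chRA e.
  exists S; split=> //.
  exact: real_closed_of_squares (real_closed_by_squares_transfer Sel sqRA).
- by move=> S [_ _ Src Ssat]; exact: real_closed_embeddings.
Qed.
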